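(* Let $r\in(0,+\infty)$, and let $\mu$ be the condensation measure associated with the condensation system $(\{f_i\}_{i=1}^N,(p_i)_{i=0}^N,\nu)$, where the maps $f_i:\mathbb{R}^d\to\mathbb{R}^d$ are bi-Lipschitz with $a_i\,\rho(x,y)\le\rho(f_i(x),f_i(y))\le b_i\,\rho(x,y)$ for all $x,y\in\mathbb{R}^d$ and $0<a_i\le b_i<1$, where $C$ is the self-conformal set generated by a conformal iterated function system $\mathcal{I}_1=(\mathbb{R}^d;\{g_j\}_{j=1}^M)$, and where $\nu$ is the image measure, with support $C$, under the coding map, of a shift-invariant ergodic probability measure $\hat\nu$ with bounded distortion on the code space $\{1,2,\dots,M\}^{\mathbb{N}}$. Assume that the condensation system satisfies the strong separation condition. Then $$\max\{d_r,D_r(\nu)\}\le\underline{D}_r(\mu),$$ where $d_r$ is uniquely determined by $\sum_{i=1}^N(p_ia_i^r)^{\frac{d_r}{r+d_r}}=1$. Furthermore, if the iterated function system $\mathcal{I}_1$ satisfies the strong separation condition, then $$\max\{d_r,D_r(\nu)\}\le\underline{D}_r(\mu)\le\overline{D}_r(\mu)\le\max\{l_r,D_r(\nu)\},$$ where $l_r$ is determined by $\sum_{i=1}^N(p_ib_i^r)^{\frac{l_r}{r+l_r}}=1$.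
   Context: Quantization. Let $\rho$ be the metric on $\mathbb{R}^d$ induced by a given norm. For a Borel probability measure $\mu$ on $\mathbb{R}^d$, $r\in(0,+\infty)$ and $n\in\mathbb{N}$, the $n$th quantization error of order $r$ is $V_{n,r}(\mu)=\inf\{\int\rho(x,A)^r\,d\mu(x): A\subset\mathbb{R}^d,\ 1\le\mathrm{card}(A)\le n\}$, where $\rho(x,A)$ is the distance from $x$ to $A$. The lower and upper quantization dimensions of order $r$ are $$\underline{D}_r(\mu)=\liminf_{n\to\infty}\frac{r\log n}{-\log V_{n,r}(\mu)},\qquad \overline{D}_r(\mu)=\limsup_{n\to\infty}\frac{r\log n}{-\log V_{n,r}(\mu)}.$$ If they coincide, the common value is the quantization dimension $D_r(\mu)$. For the measure $\nu$ described below, the quantization dimension $D_r(\nu)$ exists by a known result. Condensation system. $f_1,\dots,f_N$ are bi-Lipschitz contractions as in the claim, $(p_0,p_1,\dots,p_N)$ is a probability vector with all entries positive, and $\nu$ is a Borel probability measure supported on the compact set $C\subset\mathbb{R}^d$. There is a unique nonempty compact set $K$ (the inhomogeneous attractor) with $K=\bigcup_{i=1}^Nf_i(K)\cup C$, and a unique Borel probability measure $\mu$ (the condensation measure), with support $K$, such that $\mu=\sum_{i=1}^Np_i\,\mu\circ f_i^{-1}+p_0\nu$. The condensation system satisfies the strong separation condition if $f_i(K)\cap f_j(K)=\emptyset$ for all $1\le i\ne j\le N$ and $f_i(K)\cap C=\emptyset$ for all $1\le i\le N$. Conformal system. There is a nonempty compact set $X\subset\mathbb{R}^d$ with $X=\overline{\mathrm{int}(X)}$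 such that $g_1,\dots,g_M$ are contractions of $X$ into itself, each extending to an injective conformal map of class $C^{1+\gamma}$ (for some $\gamma>0$) on a bounded connected open set $V\supset X$ with $g_j(V)\subset V$ and nowhere vanishing derivative (conformal: the derivative at each point is a similarity), and $\|g_j'\|\le\theta$ for some $0<\theta<1$, where $\|g_j'\|$ is the sup norm of the derivative of $g_j$. $C$ is the unique nonempty compact set with $C=\bigcup_{j=1}^Mg_j(C)$ (the self-conformal set). $\mathcal{I}_1$ satisfies the strong separation condition if $g_i(C)\cap g_j(C)=\emptyset$ for $i\ne j$. The measure $\nu$. Let $\Sigma_1=\{1,\dots,M\}^{\mathbb{N}}$ and let $\Sigma_1^*$ be the set of all finite strings (including the empty one) over $\{1,\dots,M\}$. For $\omega=\omega_1\cdots\omega_n\in\Sigma_1^*$ put $g_\omega=g_{\omega_1}\circ\cdots\circ g_{\omega_n}$, $C_\omega=g_\omega(C)$, and $[\omega]=\{x\in\Sigma_1:x_i=\omega_i,\ 1\le i\le n\}$. The coding map $\pi:\Sigma_1\to C$ is $\pi(\omega)=\lim_{n\to\infty}g_{\omega_1}\circ\cdots\circ g_{\omega_n}(x)$ (independent of $x\in X$). $\hat\nu$ is a shift-invariant ergodic Borel probability measure on $\Sigma_1$ with bounded distortion: there is a constant $L\ge1$ with $L^{-1}\hat\nu([\omega])\hat\nu([\tau])\le\hat\nu([\omega\tau])\le L\,\hat\nu([\omega])\hat\nu([\tau])$ for all $\omega,\tau\in\Sigma_1^*$, where $\omega\tau$ denotes concatenation. $\nu$ is the image measure of $\hat\nu$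 under $\pi$, so that $\nu(C_\omega)=\hat\nu(\pi^{-1}(C_\omega))=\hat\nu([\omega])$ for all $\omega\in\Sigma_1^*$. *)

(* Defs.v *)
From HB Require Import structures.
From mathcomp Require Import all_boot all_order all_algebra.
From mathcomp Require Import all_classical all_reals all_analysis.
Import Order.TTheory GRing.Theory Num.Theory numFieldNormedType.Exports.

Set Implicit Arguments.
Unset Strict Implicit.
Unset Printing Implicit Defensive.

Local Open Scope classical_set_scope.
Local Open Scope ring_scope.

(* 'rV[R]_d carries the sup-norm topology of the library, which is the topology
   induced by any norm; it is used for everything topological (open, compact,
   Borel sets, differentiability). *)
Definition borel_rV (R : realType) (d : nat) :=
  g_sigma_algebraType (@open 'rV[R]_d).

Section quantization.
Context (R : realType) (d : nat).
Implicit Types (rho : 'rV[R]_d -> R) (mu : probability (borel_rV R d) R).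

(* The metric induced by the norm [rho] is [fun x y => rho (x - y)]. *)
Definition is_norm rho : Prop :=
  [/\ forall x y, rho (x + y) <= rho x + rho y,
      forall (c : R) x, rho (c *: x) = `|c| * rho x &
      forall x, rho x = 0 -> x = 0].

Definition dist_set rho (x : 'rV[R]_d) (A : set 'rV[R]_d) : R :=
  inf [set rho (x - a) | a in A].

Definition quant_error rho (r : R) mu (n : nat) : \bar R :=
  ereal_inf [set (\int[mu]_x ((dist_set rho x A) `^ r)%:E)%E
            | A in [set A : set 'rV[R]_d | A !=set0 /\ (A #<= `I_n)%card]].

(* In \bar R, lne 0 = -oo and (+oo)^-1 = 0: if the error vanishes for large n,
   the dimension is 0. *)
Definition quant_ratio rho (r : R) mu (n : nat) : \bar R :=
  ((r * ln n%:R)%:E / (- lne (quant_error rho r mu n)))%E.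

Definition lower_quant_dim rho (r : R) mu : \bar R :=
  limn_einf (quant_ratio rho r mu).

Definition upper_quant_dim rho (r : R) mu : \bar R :=
  limn_esup (quant_ratio rho r mu).

Definition is_quant_dim rho (r : R) mu (D : \bar R) : Prop :=
  lower_quant_dim rho r mu = D /\ upper_quant_dim rho r mu = D.

Definition msupport mu : set 'rV[R]_d :=
  [set x | forall U : set 'rV[R]_d, open U -> U x -> (0 < mu U)%E].

End quantization.

Section condensation.
Context (R : realType) (d N : nat).
Implicit Types (f : 'I_N -> 'rV[R]_d -> 'rV[R]_d) (C K : set 'rV[R]_d).

Definition bilipschitz (rho : 'rV[R]_d -> R) (a b : R)
    (h : 'rV[R]_d -> 'rV[R]_d) : Prop :=
  forall x y, a * rho (x - y) <= rho (h x - h y) /\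
              rho (h x - h y) <= b * rho (x - y).

Definition inhomogeneous_attractor f C K : Prop :=
  [/\ compact K, K !=set0 & K = (\bigcup_i (f i @` K)) `|` C].

Definition condensation_measure f (p0 : R) (p : 'I_N -> R)
    (nu : probability (borel_rV R d) R) K
    (mu : probability (borel_rV R d) R) : Prop :=
  (forall A : set (borel_rV R d), measurable A ->
    mu A = (\sum_i (p i)%:E * mu (f i @^-1` A) + p0%:E * nu A)%E) /\
  msupport mu = K.

Definition condensation_ssc f C K : Prop :=
  (forall i j, i != j -> f i @` K `&` f j @` K = set0) /\
  (forall i, f i @` K `&` C = set0).

(* The restriction to s >= 0 excludes the spurious root s = - r (total
   division by r + s = 0), which occurs when N = 1. *)
Definition dim_equation (r : R) (p c : 'I_N -> R) (s : R) : Prop :=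
  0 <= s /\ \sum_(i < N) (p i * c i `^ r) `^ (s / (r + s)) = 1.

End condensation.

Section conformal_ifs.
Context (R : realType) (d : nat).
Implicit Types (h : 'rV[R]_d -> 'rV[R]_d) (X V C : set 'rV[R]_d).

Definition enorm (v : 'rV[R]_d) : R := Num.sqrt (\sum_(i < d) v ord0 i ^+ 2).

Definition contraction_on X h : Prop :=
  exists c : R, [/\ 0 <= c, c < 1 &
    forall x y, X x -> X y -> enorm (h x - h y) <= c * enorm (x - y)].

Definition holder_derivative_on (gamma : R) V h : Prop :=
  exists H : R, forall x y v, V x -> V y ->
    enorm ('d h x v - 'd h y v) <= H * enorm (x - y) `^ gamma * enorm v.

(* The positive ratio says that the derivative vanishes nowhere. *)
Definition conformal_on V h : Prop :=
  forall x, V x -> exists2 s : R, 0 < s &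
    forall v, enorm ('d h x v) = s * enorm v.

Definition derivative_sup_norm V h : \bar R :=
  ereal_sup [set t | exists x v,
    [/\ V x, enorm v = 1 & t = (enorm ('d h x v))%:E]].

Definition conformal_C1holder V h : Prop :=
  [/\ set_inj V h,
      forall x, V x -> differentiable h x,
      exists2 gamma : R, 0 < gamma & holder_derivative_on gamma V h &
      conformal_on V h].

(* The maps [g j] are the extensions to V; their values outside V are
   irrelevant. *)
Record conformal_ifs (M : nat) X V (g : 'I_M -> 'rV[R]_d -> 'rV[R]_d) : Prop := {
  cifs_X_compact : compact X;
  cifs_X_nonempty : X !=set0;
  cifs_X_regular : X = closure X°;
  cifs_V_open : open V;
  cifs_V_connected : connected V;
  cifs_V_bounded : bounded_set V;
  cifs_X_sub_V : X `<=` V;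
  cifs_self_X : forall j, g j @` X `<=` X;
  cifs_contraction : forall j, contraction_on X (g j);
  cifs_self_V : forall j, g j @` V `<=` V;
  cifs_conformal : forall j, conformal_C1holder V (g j);
  cifs_derivative_bound : exists theta : R, [/\ 0 < theta, theta < 1 &
    forall j, (derivative_sup_norm V (g j) <= theta%:E)%E]
}.

Definition self_conformal_set (M : nat) X (g : 'I_M -> 'rV[R]_d -> 'rV[R]_d)
    C : Prop :=
  [/\ compact C, C !=set0, C `<=` X & C = \bigcup_j (g j @` C)].

Definition ifs_ssc (M : nat) (g : 'I_M -> 'rV[R]_d -> 'rV[R]_d) C : Prop :=
  forall i j, i != j -> g i @` C `&` g j @` C = set0.

End conformal_ifs.

HB.instance Definition _ (m : nat) := isPointed.Build 'I_m.+1 ord0.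

(* Infinite words over the m + 1 letters of 'I_m.+1 (so the alphabet is never
   empty), with the product of the discrete topologies. *)
Notation code_space m :=
  (prod_topology (fun _ : nat => discrete_topology 'I_m.+1)).

Definition borel_code (m : nat) := g_sigma_algebraType (@open (code_space m)).

Section coding.
Context (R : realType) (d m : nat).
Implicit Types (w : code_space m) (P : probability (borel_code m) R).

Definition prefix_of w (n : nat) : seq 'I_m.+1 := mkseq w n.

Definition cylinder (s : seq 'I_m.+1) : set (code_space m) :=
  [set w | prefix_of w (size s) = s].

Definition code_shift w : code_space m := fun n => w n.+1.

Definition shift_invariant P : Prop :=
  forall A : set (borel_code m), measurable A -> P (code_shift @^-1` A) = P A.

Definition shift_ergodic P : Prop :=
  forall A : set (borel_code m), measurable A ->
    code_shift @^-1` A = A -> P A = 0%E \/ P A = 1%E.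

Definition bounded_distortion P : Prop :=
  exists2 L : R, 1 <= L & forall s t : seq 'I_m.+1,
    (L^-1%:E * P (cylinder s) * P (cylinder t) <= P (cylinder (s ++ t)))%E /\
    (P (cylinder (s ++ t)) <= L%:E * P (cylinder s) * P (cylinder t))%E.

Definition word_map (g : 'I_m.+1 -> 'rV[R]_d -> 'rV[R]_d)
    (s : seq 'I_m.+1) : 'rV[R]_d -> 'rV[R]_d :=
  foldr (fun j h => g j \o h) id s.

Definition coding_map (g : 'I_m.+1 -> 'rV[R]_d -> 'rV[R]_d)
    (x : 'rV[R]_d) (w : code_space m) : 'rV[R]_d :=
  lim ((fun n => word_map g (prefix_of w n) x) @ \oo).

End coding.

(* Main.v *)
Require Import Defs.
From HB Require Import structures.
From mathcomp Require Import all_boot all_order all_algebra.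
From mathcomp Require Import all_classical all_reals all_analysis.
From mathcomp Require Import measurable_realfun ring lra.
Import Order.TTheory GRing.Theory Num.Theory numFieldNormedType.Exports.

(** Write [cost mu s] for the integral of [rho(x, s)^r] against [mu], where
   [s] is a finite list of centres, so that the n-th quantization error V_n(mu)
   is the infimum of [cost mu s] over the nonempty [s] of size at most n.
   Integrating against the defining identity of the condensation measure gives
   ([cost_condensation])

     cost mu s = sum_i p_i (int rho(f_i x, s)^r dmu(x)) + p_0 cost nu s,

   and both sides of the theorem are read off from this formula.

   - Keeping only the last term gives p_0 V_n(nu) <= V_n(mu)
     ([quant_error_ge_condensation]), hence Dnu <= lower dimension of mu.

   - For the bound by d_r it is enough to treat centres in the support K, since
     moving the centres into K costs a factor 2^r
     ([cost_ge_of_centres_in_support]). By strong separation the pieces f_i(K)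
     and C are at distances at least some e > 0 from each other. If some point
     of K is e-far from [s], the cost is bounded below by a constant, because
     balls of a fixed radius around points of K have mass bounded below.
     Otherwise every point of K has its nearest centre in its own piece; then
     every piece contains a centre, the centres in f_i(K) pull back along f_i to
     a list t_i in K, and cost mu s >= sum_i p_i a_i^r cost mu t_i with
     sum_i size t_i < size s. The weights w_i = (p_i a_i^r)^(d_r/(r+d_r)) have
     sum 1, and convexity of x^(-r/d_r) ([sum_powR_jensen]) turns this recursion
     into cost mu s >= c (size s)^(-r/d_r) ([cost_lower_bound]).

   - For the upper bound take a real s > max(l_r, Dnu). The weights
     w_i = (p_i b_i^r)^(s/(r+s)) now have sum < 1, so n centres can be shared out
     with about w_i n of them for the i-th copy of [mu] and a fixed fraction of
     n for [nu], whose error is eventually at most n^(-r/s). The recursion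
     V_n(mu) <= sum_i p_i b_i^r V_(w_i n)(mu) + p_0 V_(e n)(nu) then gives
     V_n(mu) <= c n^(-r/s) by induction ([quant_error_upper_bound]).

   As V_n(mu) tends to 0, a bound of the form c n^(-r/s) on V_n(mu) is
   equivalent, up to an arbitrarily small change of s, to a bound by s on the
   ratio r log n / (- log V_n(mu)). *)

Local Open Scope classical_set_scope.
Local Open Scope ring_scope.

(** * Logarithmic ratios of sequences that tend to zero *)

Lemma le_limn_einf (R : realType) (u : (\bar R)^nat) (x : \bar R) :
  (\forall n \near \oo, (x <= u n)%E) -> (x <= limn_einf u)%E.
Proof.
case=> n0 _ h; rewrite limn_einf_lim; apply: lime_ge; first exact: is_cvg_einfs.
near=> n; apply: le_ereal_inf_tmp => _ [k /= nk <-]; apply: h => /=.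
by apply: leq_trans nk; near: n; exists n0.
Unshelve. all: by end_near. Qed.

Lemma limn_esup_le (R : realType) (u : (\bar R)^nat) (x : \bar R) :
  (\forall n \near \oo, (u n <= x)%E) -> (limn_esup u <= x)%E.
Proof.
case=> n0 _ h; rewrite limn_esup_lim; apply: lime_le; first exact: is_cvg_esups.
near=> n; apply: ge_ereal_sup => _ [k /= nk <-]; apply: h => /=.
by apply: leq_trans nk; near: n; exists n0.
Unshelve. all: by end_near. Qed.

Lemma lt_limn_einf (R : realType) (u : (\bar R)^nat) (x : \bar R) :
  (x < limn_einf u)%E -> \forall n \near \oo, (x < u n)%E.
Proof.
move=> xu; apply: contrapT => nx.
suff : (limn_einf u <= x)%E by rewrite leNgt xu.
rewrite limn_einf_lim; apply: lime_le; first exact: is_cvg_einfs.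
near=> n; apply: contrapT => /negP; rewrite -ltNge => xn.
apply: nx; exists n => // k /= nk; apply: (lt_le_trans xn).
by apply: ereal_inf_lbound; exists k.
Unshelve. all: by end_near. Qed.

Lemma limn_esup_lt (R : realType) (u : (\bar R)^nat) (x : \bar R) :
  (limn_esup u < x)%E -> \forall n \near \oo, (u n < x)%E.
Proof.
move=> xu; apply: contrapT => nx.
suff : (x <= limn_esup u)%E by rewrite leNgt xu.
rewrite limn_esup_lim; apply: lime_ge; first exact: is_cvg_esups.
near=> n; apply: contrapT => /negP; rewrite -ltNge => xn.
apply: nx; exists n => // k /= nk; apply: le_lt_trans xn.
by apply: ereal_sup_ubound; exists k.
Unshelve. all: by end_near. Qed.

Lemma near_ge_ln_nat (R : realType) (B : R) :
  \forall n \near \oo, B <= ln (n%:R : R).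
Proof.
near=> n.
have n0 : 0 < (n%:R : R).
  by rewrite ltr0n; near: n; exists 1%N.
rewrite -ler_expR lnK ?posrE//.
near: n; exact: nbhs_infty_ger.
Unshelve. all: by end_near. Qed.

Section log_ratio.
Context {R : realType} (r : R) (e : (\bar R)^nat).
Hypotheses (r0 : 0 < r) (e0 : forall n, (0 <= e n)%E).

(** [quant_ratio rho r mu] is, by conversion, this ratio for the sequence of
   quantization errors of [mu]. *)
Definition log_ratio : (\bar R)^nat :=
  fun n => ((r * ln n%:R)%:E / (- lne (e n)))%E.

Definition vanishing := forall eps : R, 0 < eps ->
  \forall n \near \oo, (e n < eps%:E)%E.

Lemma log_ratioE n (v : R) : e n = v%:E -> 0 < v -> v < 1 ->
  log_ratio n = (r * ln n%:R / - ln v)%:E.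
Proof.
move=> en v0 v1; rewrite /log_ratio en lne_EFin// -EFinN inver.
by rewrite oppr_eq0 lt_eqF ?ln_lt0 ?v0.
Qed.

Lemma log_ratio0 n : e n = 0%E -> log_ratio n = 0%E.
Proof. by move=> en; rewrite /log_ratio en le0_lneNy//= invey mule0. Qed.

(** Errors equal to 0 are kept apart because the ratio is then 0 by
   convention. *)
Lemma lt1_cases n : (e n < 1)%E ->
  e n = 0%E \/ exists v : R, [/\ e n = v%:E, 0 < v & v < 1].
Proof.
move=> en1; have := e0 n; case: (e n) en1 => [v| |]//=.
rewrite lte_fin lee_fin => v1; rewrite le_eqVlt => /predU1P[<-|v0]; first by left.
by right; exists v.
Qed.

Hypothesis esmall : vanishing.

Lemma log_ratio_ge0 : \forall n \near \oo, (0 <= log_ratio n)%E.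
Proof.
near=> n.
have : (e n < 1)%E by near: n; exact: esmall.
case/lt1_cases => [/log_ratio0 -> //|[v [en v0 v1]]].
rewrite (log_ratioE _ _ en)// lee_fin divr_ge0//.
  apply: mulr_ge0; first exact: ltW.
  by near: n; apply: near_ge_ln_nat.
by rewrite oppr_ge0 ltW// ln_lt0 ?v0.
Unshelve. all: by end_near. Qed.

Lemma limn_einf_log_ratio_ge0 : (0 <= limn_einf log_ratio)%E.
Proof. exact/le_limn_einf/log_ratio_ge0. Qed.

(** If [e n >= c n^(-r/s)] then [- ln (e n)] is at most
   [(r / s) ln n - ln c]; the constant [c] is absorbed by decreasing [s] to
   [s'] and taking [n] large. *)
Lemma limn_einf_log_ratio_ge (c s : R) : 0 < c -> 0 < s ->
  (\forall n \near \oo, ((c * n%:R `^ (- (r / s)))%:E <= e n)%E) ->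
  (s%:E <= limn_einf log_ratio)%E.
Proof.
move=> c0 s0 h.
suff H s' : 0 < s' -> s' < s -> (s'%:E <= limn_einf log_ratio)%E.
  apply/lee_subgt0Pr => _/posnumP[x]; rewrite -EFinB.
  have [sx|sx] := ltP 0 (s - x%:num); last first.
    by apply: le_trans limn_einf_log_ratio_ge0; rewrite lee_fin.
  by apply: H => //; rewrite gtrBl.
move=> s'0 s's; apply: le_limn_einf; near=> n.
have n0 : 0 < (n%:R : R).
  by rewrite ltr0n; near: n; exists 1%N.
have cn0 : 0 < c * n%:R `^ (- (r / s)) by rewrite mulr_gt0// powR_gt0.
have : (e n < 1)%E by near: n; exact: esmall.
have cn : ((c * n%:R `^ (- (r / s)))%:E <= e n)%E by near: n.
case/lt1_cases => [en|[v [en v0 v1]]].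
  by move: cn; rewrite en lee_fin leNgt cn0.
rewrite (log_ratioE _ _ en)// lee_fin.
have lv0 : ln v < 0 by rewrite ln_lt0// v0.
rewrite ler_pdivlMr ?oppr_gt0//.
have vl : ln c - r / s * ln n%:R <= ln v.
  move: cn; rewrite en lee_fin -ler_ln ?posrE// lnM ?posrE ?powR_gt0//.
  by rewrite ln_powR mulNr.
have : (- (s' * ln c)) / (r * (1 - s' / s)) <= ln (n%:R : R).
  by near: n; exact: near_ge_ln_nat.
have ss : 0 < 1 - s' / s by rewrite subr_gt0 ltr_pdivrMr// mul1r.
rewrite ler_pdivrMr ?mulr_gt0// => hL.
apply: (@le_trans _ _ (s' * - (ln c - r / s * ln n%:R))).
  by rewrite ler_pM2l// lerN2.
have -> : r * ln (n%:R : R) =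
   ln n%:R * (r * (1 - s' / s)) + s' * (r / s * ln n%:R) by field; rewrite gt_eqF.
lra.
Unshelve. all: by end_near. Qed.

Lemma limn_esup_log_ratio_le (c s : R) : 0 < c -> 0 < s ->
  (\forall n \near \oo, (e n <= (c * n%:R `^ (- (r / s)))%:E)%E) ->
  (limn_esup log_ratio <= s%:E)%E.
Proof.
move=> c0 s0 h.
suff H s' : s < s' -> (limn_esup log_ratio <= s'%:E)%E.
  apply/lee_addgt0Pr => _/posnumP[x]; rewrite -EFinD.
  by apply: H; rewrite ltrDl.
move=> ss'; have s'0 := lt_trans s0 ss'; apply: limn_esup_le; near=> n.
have n0 : 0 < (n%:R : R).
  by rewrite ltr0n; near: n; exists 1%N.
have cn0 : 0 < c * n%:R `^ (- (r / s)) by rewrite mulr_gt0// powR_gt0.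
have : (e n < 1)%E by near: n; exact: esmall.
have cn : (e n <= (c * n%:R `^ (- (r / s)))%:E)%E by near: n.
case/lt1_cases => [en|[v [en v0 v1]]].
  by rewrite log_ratio0// lee_fin ltW.
rewrite (log_ratioE _ _ en)// lee_fin.
have lv0 : ln v < 0 by rewrite ln_lt0// v0.
rewrite ler_pdivrMr ?oppr_gt0//.
have vl : ln v <= ln c - r / s * ln n%:R.
  move: cn; rewrite en lee_fin -[v <= _]ler_ln ?posrE// lnM ?posrE ?powR_gt0//.
  by rewrite ln_powR mulNr.
have : (s' * ln c) / (r * (s' / s - 1)) <= ln (n%:R : R).
  by near: n; exact: near_ge_ln_nat.
have ss : 0 < s' / s - 1 by rewrite subr_gt0 ltr_pdivlMr// mul1r.
rewrite ler_pdivrMr ?mulr_gt0// => hL.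
apply: (@le_trans _ _ (s' * - (ln c - r / s * ln n%:R))); last first.
  by rewrite ler_pM2l// lerN2.
have -> : r * ln (n%:R : R) =
   s' * (r / s * ln n%:R) - ln n%:R * (r * (s' / s - 1)) by field; rewrite gt_eqF.
lra.
Unshelve. all: by end_near. Qed.

Lemma near_ge_of_lt_limn_einf (s : R) : 0 < s ->
  (s%:E < limn_einf log_ratio)%E ->
  \forall n \near \oo, ((n%:R `^ (- (r / s)))%:E <= e n)%E.
Proof.
move=> s0 /lt_limn_einf h; near=> n.
have n0 : 0 < (n%:R : R).
  by rewrite ltr0n; near: n; exists 1%N.
have : (e n < 1)%E by near: n; exact: esmall.
have : (s%:E < log_ratio n)%E by near: n.
move=> sn /lt1_cases[en|[v [en v0 v1]]].
  by move: sn; rewrite log_ratio0// lte_fin ltNge ltW.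
move: sn; rewrite (log_ratioE _ _ en)// en lte_fin lee_fin.
have lv0 : ln v < 0 by rewrite ln_lt0// v0.
rewrite ltr_pdivlMr ?oppr_gt0// => hs.
rewrite -ler_ln ?posrE ?powR_gt0// ln_powR.
rewrite -(ler_pM2l s0).
have -> : s * (- (r / s) * ln (n%:R : R)) = - (r * ln n%:R) by field; rewrite gt_eqF.
lra.
Unshelve. all: by end_near. Qed.

Lemma near_le_of_limn_esup_lt (s : R) : 0 < s ->
  (limn_esup log_ratio < s%:E)%E ->
  \forall n \near \oo, (e n <= (n%:R `^ (- (r / s)))%:E)%E.
Proof.
move=> s0 /limn_esup_lt h; near=> n.
have n0 : 0 < (n%:R : R).
  by rewrite ltr0n; near: n; exists 1%N.
have : (e n < 1)%E by near: n; exact: esmall.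
have : (log_ratio n < s%:E)%E by near: n.
move=> sn /lt1_cases[en|[v [en v0 v1]]].
  by rewrite en lee_fin powR_ge0.
move: sn; rewrite (log_ratioE _ _ en)// en lte_fin lee_fin.
have lv0 : ln v < 0 by rewrite ln_lt0// v0.
rewrite ltr_pdivrMr ?oppr_gt0// => hs.
rewrite -ler_ln ?posrE ?powR_gt0// ln_powR.
rewrite -(ler_pM2l s0).
have -> : s * (- (r / s) * ln (n%:R : R)) = - (r * ln n%:R) by field; rewrite gt_eqF.
lra.
Unshelve. all: by end_near. Qed.

End log_ratio.

Lemma ereal_real_dense (R : realType) (x y : \bar R) : (x < y)%E ->
  exists s : R, (x < s%:E < y)%E.
Proof.
case: x y => [x| |] [y| |]//; rewrite ?lte_fin => xy.
- by exists ((x + y) / 2); rewrite !lte_fin !midf_lt.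
- by exists (x + 1); rewrite lte_fin ltrDl ltr01 ltry.
- by exists (y - 1); rewrite lte_fin ltrBlDr ltrDl ltr01 ltNyr.
- by exists 0; rewrite ltNyr ltry.
Qed.

(** * The dimension equation and Jensen's inequality *)

Lemma powRr_continuous (R : realType) (q : R) : 0 < q ->
  continuous (fun u : R => q `^ u).
Proof.
move=> q0 u; rewrite /powR gt_eqF//.
apply: continuous_cvg; first exact: continuous_expR.
by apply: cvgM; [exact: cvg_id|exact: cvg_cst].
Qed.

Section dimension_equation.
Context {R : realType} {N : nat} (q : 'I_N -> R).
Hypotheses (N0 : (0 < N)%N) (q01 : forall i, 0 < q i < 1).

Lemma sum_powR_decreasing (u v : R) : u < v ->
  \sum_i q i `^ v < \sum_i q i `^ u.
Proof.
move=> uv; apply: ltr_sum => [|i _].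
  by apply/hasP; exists (Ordinal N0); rewrite ?mem_index_enum.
have /andP[qi0 qi1] := q01 i.
rewrite -ltr_ln ?posrE ?powR_gt0// !ln_powR.
by rewrite ltr_nM2r// ln_lt0// q01.
Qed.

Lemma sum_powR_eq1 : \sum_i q i < 1 ->
  exists2 u, 0 <= u < 1 & \sum_i q i `^ u = 1.
Proof.
move=> q1; pose phi u := \sum_i q i `^ u.
have phi0 : 1 <= phi 0.
  rewrite /phi (eq_bigr (fun=> 1)) => [|i _]; last by rewrite powRr0.
  by rewrite sumr_const card_ord ler1n.
have phi1 : phi 1 < 1.
  by rewrite /phi (eq_bigr q)// => i _; rewrite powRr1// ltW//; case/andP: (q01 i).
have phic : {within `[0, 1], continuous phi}.
  apply: continuous_subspaceT; apply: continuous_big => [|i _].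
    exact: add_continuous.
  by apply: powRr_continuous; case/andP: (q01 i).
have [||u] := @IVT _ phi 0 1 1 _ phic; first exact: ler01.
  by rewrite ge_min le_max phi0 (ltW phi1) orbT.
rewrite in_itv/= => /andP[u0 u1] phiu; exists u => //; rewrite u0/= lt_neqAle u1 andbT.
by apply/eqP => u1'; move: phi1; rewrite -{1}u1' phiu ltxx.
Qed.

End dimension_equation.

Lemma dim_exponent_lt (R : realType) (r s t : R) : 0 < r -> 0 <= s -> s < t ->
  s / (r + s) < t / (r + t).
Proof.
move=> r0 s0 st; have t0 := le_lt_trans s0 st.
rewrite ltr_pdivrMr ?ltr_pwDl// mulrAC ltr_pdivlMr ?ltr_pwDl ?ltW//.
by rewrite !mulrDr [t * s]mulrC ltrD2r ltr_pM2r.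
Qed.

(** The change of variable [u = s / (r + s)] is an increasing bijection from
   the nonnegative reals to [0, 1), on which [sum_i q_i^u] decreases strictly
   from [N >= 1] to a limit below 1. *)
Lemma dim_equation_unique (R : realType) (N : nat) (r : R) (p c : 'I_N -> R) :
  (0 < N)%N -> 0 < r -> (forall i, 0 < p i * c i `^ r < 1) ->
  \sum_i p i * c i `^ r < 1 ->
  exists s, unique (dim_equation r p c) s.
Proof.
move=> N0 r0 q01 q1; have [u /andP[u0 u1] su] := sum_powR_eq1 _ N0 q01 q1.
have u1' : 0 < 1 - u by rewrite subr_gt0.
have H : r * u / (1 - u) / (r + r * u / (1 - u)) = u.
  by field; rewrite gt_eqF//= (_ : _ + _ = r) ?gt_eqF//; ring.
have u0' : 0 <= r * u / (1 - u) by rewrite divr_ge0 ?mulr_ge0// ltW.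
exists (r * u / (1 - u)); split; first by split; rewrite ?H.
move=> s [s0 ss]; case: (ltgtP (r * u / (1 - u)) s) => // st.
- have := sum_powR_decreasing _ N0 q01 _ _ (dim_exponent_lt _ _ _ _ r0 u0' st).
  by rewrite H ss su ltxx.
- have := sum_powR_decreasing _ N0 q01 _ _ (dim_exponent_lt _ _ _ _ r0 s0 st).
  by rewrite H ss su ltxx.
Qed.

(** The convex function [y^(-q)] lies above its tangent line at 1. *)
Lemma powR_tangent (R : realType) (q y : R) : 0 < q -> 0 < y ->
  1 + q - q * y <= y `^ (- q).
Proof.
move=> q0 y0; rewrite /powR gt_eqF//; apply: le_trans (expR_ge1Dx _).
have := @le_ln1Dx _ (y - 1); rewrite ltrBrDl subrr => /(_ y0).
rewrite subrKC => h; rewrite -addrA lerD2l mulNr -{1}[q]mulr1 -mulrBr -mulrN.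
by rewrite ler_pM2l// lerNr opprB.
Qed.

(** Jensen's inequality for the convex function [y^(-q)], the weights [t i]
   and the points [x i / t i], as [t^(1+q) x^(-q) = t (x / t)^(-q)]. *)
Lemma sum_powR_jensen (R : realType) (N : nat) (t x : 'I_N -> R) (q : R) :
  0 < q -> (0 < N)%N -> (forall i, 0 < t i) -> \sum_i t i = 1 ->
  (forall i, 0 < x i) ->
  (\sum_i x i) `^ (- q) <= \sum_i t i `^ (1 + q) * x i `^ (- q).
Proof.
move=> q0 N0 t0 t1 x0; set S := \sum_i x i.
have S0 : 0 < S.
  rewrite /S (bigD1 (Ordinal N0))//= ltr_pwDl//.
  by apply: sumr_ge0 => i _; exact: ltW.
(* Normalised so that the mean of the y i for the weights t i is 1. *)
pose y i := x i / (t i * S).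
have y0 i : 0 < y i by rewrite divr_gt0 ?mulr_gt0.
have E i : t i `^ (1 + q) * x i `^ (- q) = S `^ (- q) * (t i * y i `^ (- q)).
  rewrite [in LHS](_ : x i = y i * (t i * S)); last first.
    by rewrite /y divfK// gt_eqF// mulr_gt0.
  move: (y i) (y0 i) => z z0; rewrite !powRM ?mulr_ge0 ?(ltW z0) ?(ltW (t0 i)) ?(ltW S0)//.
  have -> : t i `^ (1 + q) = t i * t i `^ q.
    by rewrite powRD ?powRr1 ?(ltW (t0 i))// (gt_eqF (t0 i)) implybT.
  have -> : t i `^ q = (t i `^ (- q))^-1 by rewrite powRN invrK.
  by field; rewrite gt_eqF// powR_gt0.
rewrite (eq_bigr _ (fun i _ => E i)) -mulr_sumr ler_peMr ?powR_ge0//.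
apply: (@le_trans _ _ (\sum_i t i * (1 + q - q * y i))); last first.
  by apply: ler_sum => i _; rewrite ler_pM2l// powR_tangent.
under eq_bigr do rewrite mulrBr.
rewrite big_split/= sumrN -mulr_suml t1 mul1r.
have -> : \sum_i t i * (q * y i) = q; last by rewrite addrK.
rewrite (eq_bigr (fun i => q / S * x i)) => [|i _].
  by rewrite -mulr_sumr -/S divfK// gt_eqF.
by rewrite /y; field; rewrite !gt_eqF.
Qed.

(** * Norms on row vectors and continuity *)

Section norm_topology.
Context {R : realType} {d : nat} (rho : 'rV[R]_d -> R).
Hypothesis hrho : is_norm rho.

Lemma is_norm0 : rho 0 = 0.
Proof. by case: hrho => _ /(_ 0 0) + _; rewrite scale0r normr0 mul0r. Qed.

Lemma is_normN x : rho (- x) = rho x.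
Proof. by case: hrho => _ /(_ (-1) x) + _; rewrite scaleN1r normrN1 mul1r. Qed.

Lemma is_norm_distC x y : rho (x - y) = rho (y - x).
Proof. by rewrite -is_normN opprB. Qed.

Lemma is_norm_ge0 x : 0 <= rho x.
Proof.
case: hrho => /(_ x (- x)) + _ _; rewrite subrr is_norm0 is_normN.
by rewrite -mulr2n -mulr_natr pmulr_lge0.
Qed.

Lemma is_norm_distD z x y : rho (x - y) <= rho (x - z) + rho (z - y).
Proof. by case: hrho => /(_ (x - z) (z - y)) + _ _; rewrite subrKA. Qed.

Lemma is_norm_bounded : exists2 M, 0 < M & forall x, rho x <= M * `|x|.
Proof.
exists (1 + \sum_i rho (delta_mx 0 i)).
  by rewrite ltr_pwDl// sumr_ge0// => i _; exact: is_norm_ge0.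
move=> x; rewrite mulrDl mul1r mulr_suml [in X in X <= _](row_sum_delta x).
rewrite -[leLHS]add0r lerD//.
have H (s : seq 'I_d) : rho (\sum_(j <- s) x 0 j *: delta_mx 0 j) <=
    \sum_(j <- s) rho (delta_mx 0 j) * `|x|.
  elim: s => [|j s IH]; first by rewrite !big_nil is_norm0.
  rewrite !big_cons; case: (hrho) => /(_ _ _)/le_trans + Z _; apply.
  apply: lerD => //; rewrite Z mulrC ler_wpM2l ?is_norm_ge0//.
  rewrite [leRHS]/Num.Def.normr/= mx_normrE; apply: le_trans (le_bigmax _ _ (0, j)) => //.
exact: H.
Qed.

(** Exchanging the arguments shows that a one-sided bound suffices. *)
Lemma lipschitz_rV_continuous (u : 'rV[R]_d -> R) (c : R) :
  (forall x y, u x - u y <= c * rho (x - y)) -> continuous u.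
Proof.
move=> uc; have [M M0 HM] := is_norm_bounded.
have c0 : 0 < `|c| + 1 by rewrite ltr_wpDl.
move=> x; apply/(@cvgrPdist_lt _ _ _ (nbhs x)) => e e0; apply/nbhs_ballP.
exists (e / ((`|c| + 1) * M)) => [|y]; first by rewrite /= divr_gt0// mulr_gt0.
rewrite mx_norm_ball /ball_/= => xy; move: xy.
rewrite ltr_pdivlMr ?mulr_gt0// => h.
have {}h : c * rho (x - y) < e.
  apply: le_lt_trans h; rewrite mulrCA.
  apply: (@le_trans _ _ ((`|c| + 1) * rho (x - y))).
    by rewrite ler_wpM2r ?is_norm_ge0// (le_trans (ler_norm _))// lerDl.
  by rewrite ler_pM2l// mulrC.
rewrite ltr_norml ltrNl opprB !(le_lt_trans (uc _ _))//.
by rewrite is_norm_distC.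
Qed.

Lemma is_norm_dist_continuous z : continuous (fun x : 'rV[R]_d => rho (x - z)).
Proof.
apply: (@lipschitz_rV_continuous _ 1) => x y.
by rewrite mul1r lerBlDr; exact: is_norm_distD.
Qed.

Lemma is_norm_continuous : continuous rho.
Proof.
apply: (@lipschitz_rV_continuous _ 1) => x y; rewrite mul1r lerBlDr.
by have := is_norm_distD y x 0; rewrite !subr0.
Qed.

(** [rho] is continuous, so it attains a positive minimum on the unit sphere
   of the sup norm, which is compact. *)
Lemma norm_le_is_norm : exists2 M, 0 < M & forall x, `|x| <= M * rho x.
Proof.
pose S := [set x : 'rV[R]_d | `|x| = 1].
have [S0|S0] := eqVneq S set0.
  exists 1 => // x; have [->|x0] := eqVneq x 0.
    by rewrite normr0 mul1r is_norm_ge0.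
  have : S (`|x|^-1 *: x).
    by rewrite /S/= normrZ normfV normr_id mulVf// normr_eq0.
  by rewrite S0.
have cS : compact S.
  apply: bounded_closed_compact.
    by exists 1; split=> [//|y y1 x /= ->]; exact: ltW.
  rewrite (_ : S = (fun x => `|x|) @^-1` [set 1])//.
  apply: closed_comp => // x _; exact: norm_continuous.
have cr : {within S, continuous rho}.
  by apply: continuous_subspaceT; exact: is_norm_continuous.
have [c /set_mem Sc cmin] := EVT_min_rV (proj1 (set0P _) S0) cS cr.
have c0 : 0 < rho c.
  rewrite lt0r is_norm_ge0 andbT; apply/eqP; case: hrho => _ _ /[apply] ce.
  by move: Sc; rewrite /S/= ce normr0 => /esym/eqP; rewrite oner_eq0.
exists (rho c)^-1; first by rewrite invr_gt0.
move=> x; have [->|x0] := eqVneq x 0; first by rewrite normr0 is_norm0 mulr0.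
have nx0 : 0 < `|x| by rewrite normr_gt0.
have := cmin (`|x|^-1 *: x).
rewrite inE /S/= normrZ normfV normr_id mulVf ?normr_eq0// => /(_ erefl).
case: hrho => _ -> _; rewrite normfV normr_id mulrC ler_pdivlMr// => h.
by rewrite mulrC ler_pdivlMr// mulrC.
Qed.

Lemma lipschitz_map_continuous (h : 'rV[R]_d -> 'rV[R]_d) (b : R) : 0 <= b ->
  (forall x y, rho (h x - h y) <= b * rho (x - y)) -> continuous h.
Proof.
move=> b0 hb; have [M M0 HM] := norm_le_is_norm.
have [M' M'0 HM'] := is_norm_bounded.
have H x y : `|h x - h y| <= M * ((b + 1) * M') * `|x - y|.
  apply: (le_trans (HM _)); rewrite -!mulrA ler_pM2l//.
  apply: (le_trans (hb _ _)); apply: ler_pM => //; first exact: is_norm_ge0.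
  by rewrite lerDl.
have c0 : 0 < M * ((b + 1) * M') by rewrite !mulr_gt0// ltr_wpDl.
move=> x; apply/(@cvgrPdist_lt _ _ _ (nbhs x)) => e e0; apply/nbhs_ballP.
exists (e / (M * ((b + 1) * M'))) => [|y]; first by rewrite /= divr_gt0.
rewrite mx_norm_ball /ball_/= => xy.
by apply: (le_lt_trans (H _ _)); rewrite mulrC -ltr_pdivlMr.
Qed.

End norm_topology.

(** * Quantization by lists of centres *)

Section quantization_cost.
Context {R : realType} {d : nat} (rho : 'rV[R]_d -> R).
Hypothesis hrho : is_norm rho.
Implicit Types s : seq 'rV[R]_d.

Lemma dist_set_ge0 x (A : set 'rV[R]_d) : A !=set0 -> 0 <= dist_set rho x A.
Proof.
move=> A0; apply: lb_le_inf; first exact: image_nonempty.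
by move=> _ [a _ <-]; exact: is_norm_ge0.
Qed.

Lemma dist_set_le x (A : set 'rV[R]_d) a : A a -> dist_set rho x A <= rho (x - a).
Proof.
move=> Aa; apply: ge_inf; last by exists a.
by exists 0 => _ [b _ <-]; exact: is_norm_ge0.
Qed.

Lemma le_dist_set x (A : set 'rV[R]_d) t : A !=set0 ->
  (forall a, A a -> t <= rho (x - a)) -> t <= dist_set rho x A.
Proof.
move=> A0 h; apply: lb_le_inf; first exact: image_nonempty.
by move=> _ [a Aa <-]; exact: h.
Qed.

Lemma dist_set_seq_attained x s : s != [::] ->
  exists2 a, a \in s & dist_set rho x [set` s] = rho (x - a).
Proof.
move=> s0; suff [a sa amin] : exists2 a, a \in s &
    forall b, b \in s -> rho (x - a) <= rho (x - b).
  exists a => //; apply/eqP; rewrite eq_le dist_set_le//= le_dist_set//.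
  by exists a.
elim: s s0 => // b s IH _; have [->|/IH[a sa amin]] := eqVneq s [::].
  by exists b; [rewrite mem_head|move=> c; rewrite inE => /eqP ->].
have [ab|/ltW ba] := lerP (rho (x - a)) (rho (x - b)).
  exists a => [|c]; first by rewrite inE sa orbT.
  by rewrite inE => /predU1P[-> //|]; exact: amin.
exists b => [|c]; first by rewrite mem_head.
by rewrite inE => /predU1P[-> //|/amin]; exact: le_trans.
Qed.

Lemma dist_set_seq_lipschitz x y s : s != [::] ->
  dist_set rho x [set` s] - dist_set rho y [set` s] <= rho (x - y).
Proof.
move=> s0; have [a sa ->] := dist_set_seq_attained y s s0.
rewrite lerBlDr (le_trans _ (is_norm_distD _ hrho y _ _))//.
exact: dist_set_le.
Qed.

(** Lists of centres replace sets of cardinality at most [n], so that centres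
   can be counted and induction on their number is available. *)
Lemma card_le_seqP (A : set 'rV[R]_d) n : (A #<= `I_n)%card ->
  exists2 s, A = [set` s] & (size s <= n)%N.
Proof.
move=> /pcard_surjP[g gA].
exists [seq y <- map g (iota 0 n) | `[< A y >]]; last first.
  by rewrite size_filter (leq_trans (count_size _ _))// size_map size_iota.
apply/seteqP; split => y /=; rewrite mem_filter; last by case/andP => /asboolP.
move=> Ay; apply/andP; split; first exact/asboolP.
have [i /= iltn <-] := gA y Ay; by apply: map_f; rewrite mem_iota.
Qed.

Lemma seq_card_le s n : (size s <= n)%N -> ([set` s] #<= `I_n)%card.
Proof.
move=> sn; apply: (@card_le_trans _ _ _ `I_(size s)); last by rewrite card_le_II.
apply: card_le_trans (card_image_le (nth 0 s) _).
apply: subset_card_le => x /= xs; exists (index x s); first by rewrite /= index_mem.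
by rewrite nth_index.
Qed.

Lemma continuous_measurable_rV (u : 'rV[R]_d -> R) : continuous u ->
  measurable_fun [set: borel_rV R d] (u : borel_rV R d -> R).
Proof.
move=> /continuousP cu; apply: (measurability _ (RGenOpens.measurableE R)).
move=> _ [_ [a [b ->] <-]]; rewrite setTI; apply: sub_sigma_algebra.
exact/cu/interval_open.
Qed.

Lemma continuous_measurable_map (h : 'rV[R]_d -> 'rV[R]_d) : continuous h ->
  measurable_fun [set: borel_rV R d] (h : borel_rV R d -> borel_rV R d).
Proof.
move=> /continuousP ch; apply: (measurability (@open 'rV[R]_d : set (set (borel_rV R d)))) => //.
by move=> _ [U oU <-]; rewrite setTI; apply: sub_sigma_algebra; exact: ch.
Qed.

Variable r : R.

Lemma measurable_scaled_dist_powR k s : s != [::] ->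
  measurable_fun [set: borel_rV R d]
  ((fun x => ((k * dist_set rho x [set` s]) `^ r)%:E) : borel_rV R d -> \bar R).
Proof.
move=> s0; apply/measurable_EFinP; apply: (measurableT_comp (measurable_powR _)).
apply: measurable_funM => //; apply: continuous_measurable_rV.
apply: (lipschitz_rV_continuous _ hrho _ 1) => x y.
by rewrite mul1r dist_set_seq_lipschitz.
Qed.

Lemma measurable_dist_powR s : s != [::] -> measurable_fun [set: borel_rV R d]
  ((fun x => ((dist_set rho x [set` s]) `^ r)%:E) : borel_rV R d -> \bar R).
Proof.
move=> /(measurable_scaled_dist_powR 1); congr (measurable_fun _ _).
by apply/funext => x; rewrite mul1r.
Qed.

Definition cost (mu : probability (borel_rV R d) R) s : \bar R :=
  (\int[mu]_x ((dist_set rho x [set` s]) `^ r)%:E)%E.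

Variable mu : probability (borel_rV R d) R.

Lemma cost_ge0 s : (0 <= cost mu s)%E.
Proof. by apply: integral_ge0 => x _; rewrite lee_fin powR_ge0. Qed.

Lemma quant_error_ge0 n : (0 <= quant_error rho r mu n)%E.
Proof.
apply: le_ereal_inf_tmp => _ [A _ <-].
by apply: integral_ge0 => x _; rewrite lee_fin powR_ge0.
Qed.

Lemma quant_error_le_cost n s : s != [::] -> (size s <= n)%N ->
  (quant_error rho r mu n <= cost mu s)%E.
Proof.
move=> s0 sn; apply: ereal_inf_lbound; exists [set` s] => //; split.
  by case: s s0 {sn} => // a s _; exists a; rewrite /= mem_head.
exact: seq_card_le.
Qed.

Lemma quant_error_ge n x :
  (forall s, s != [::] -> (size s <= n)%N -> (x <= cost mu s)%E) ->
  (x <= quant_error rho r mu n)%E.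
Proof.
move=> h; apply: le_ereal_inf_tmp => _ [A [A0 /card_le_seqP[s As sn]] <-].
rewrite As; apply: h => //; apply/eqP => s0.
by case: A0 => a; rewrite As s0.
Qed.

Lemma quant_error_lt n x : (quant_error rho r mu n < x)%E ->
  exists s, [/\ s != [::], (size s <= n)%N & (cost mu s < x)%E].
Proof.
move=> h; apply: contrapT => ns; suff : (x <= quant_error rho r mu n)%E.
  by rewrite leNgt h.
apply: quant_error_ge => s s0 sn; rewrite leNgt; apply/negP => sx.
by apply: ns; exists s.
Qed.

End quantization_cost.

Section integral_sum_measures.
Context {R : realType} {disp : measure_display} {T : measurableType disp}.

Lemma integral_finite_sum_measures (N : nat) (m : 'I_N -> {measure set T -> \bar R})
    (h : T -> \bar R) : (forall x, (0 <= h x)%E) -> measurable_fun setT h ->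
  forall mu : {measure set T -> \bar R},
  (forall A, measurable A -> mu A = (\sum_i m i A)%E) ->
  (\int[mu]_x h x = \sum_i \int[m i]_x h x)%E.
Proof.
move=> h0 mh mu muE.
pose M (k : nat) : {measure set T -> \bar R} :=
  if insub k is Some i then m i else (mzero : {measure set T -> \bar R}).
have ME (i : 'I_N) : M i = m i by rewrite /M valK.
rewrite (eq_measure_integral (msum M N)) => [|A mA _].
  rewrite ge0_integral_measure_sum//.
  by apply: eq_bigr => i _; rewrite ME.
by rewrite muE// /msum; apply: eq_bigr => i _; rewrite ME.
Qed.

End integral_sum_measures.

(** The condensation identity says that [mu] is a finite sum of scaled
   pushforwards of [mu] and of a scaled copy of [nu]. *)
Lemma integral_condensation (R : realType) (d N : nat)
    (f : 'I_N -> 'rV[R]_d -> 'rV[R]_d) (p0 : R) (p : 'I_N -> R)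
    (nu mu : probability (borel_rV R d) R) (h : borel_rV R d -> \bar R) :
  (forall i, continuous (f i)) -> 0 <= p0 -> (forall i, 0 <= p i) ->
  (forall A : set (borel_rV R d), measurable A ->
    mu A = (\sum_i (p i)%:E * mu (f i @^-1` A) + p0%:E * nu A)%E) ->
  (forall x, (0 <= h x)%E) -> measurable_fun setT h ->
  (\int[mu]_x h x =
   \sum_i (p i)%:E * \int[mu]_x h (f i x) + p0%:E * \int[nu]_x h x)%E.
Proof.
move=> cf p00 pi0 muE h0 mh.
have mf i := continuous_measurable_map _ (cf i).
(* The measure structure of a pushforward takes the measurability proof as an argument. *)
pose mu_ i := measure_function_pushforward__canonical__measure_function_Measure mu (mf i).
pose m (i : 'I_N.+1) : {measure set (borel_rV R d) -> \bar R} :=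
  if unlift ord0 i is Some j then mscale (NngNum (pi0 j)) (mu_ j)
  else mscale (NngNum p00) nu.
rewrite (integral_finite_sum_measures N.+1 m)// => [|A mA]; last first.
  apply: (eq_trans (muE A mA)); rewrite big_ord_recl addeC /m unlift_none; congr (_ + _)%E.
  by apply: eq_bigr => i _; rewrite liftK.
rewrite big_ord_recl addeC /m unlift_none ge0_integral_mscale//; congr (_ + _)%E.
apply: eq_bigr => i _; rewrite liftK ge0_integral_mscale//.
by rewrite ge0_integral_pushforward.
Qed.

(** * Supports and compact sets *)

Lemma exists_uniform_pos (R : realType) (T : eqType) (s : seq T)
    (P : T -> R -> Prop) :
  (forall t e e', e' <= e -> P t e -> P t e') ->
  (forall t, t \in s -> exists2 e, 0 < e & P t e) ->
  exists2 e, 0 < e & forall t, t \in s -> P t e.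
Proof.
move=> Pm; elim: s => [_|t s IH h]; first by exists 1.
have [e e0 He] := IH (fun u us => h u (mem_behead (s := t :: s) us)).
have [e' e'0 He'] := h t (mem_head _ _).
exists (Num.min e e'); first by rewrite lt_min e0.
move=> u; rewrite inE => /predU1P[->|/He].
  by apply: Pm He'; rewrite ge_min lexx orbT.
by apply: Pm; rewrite ge_min lexx.
Qed.

(** Every point outside the support lies in a null ball with rational centre
   and radius 1/(k+1), and there are only countably many such balls. *)
Lemma msupport_ae (R : realType) (d : nat) (mu : probability (borel_rV R d) R) :
  mu.-negligible (~` msupport mu).
Proof.
pose B (q : 'rV[rat]_d * nat) : set 'rV[R]_d :=
  ball (map_mx ratr q.1 : 'rV[R]_d) (q.2.+1%:R^-1).
have mB q : measurable (B q : set (borel_rV R d)).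
  apply: sub_sigma_algebra; exact: ball_open.
pose F (n : nat) : set (borel_rV R d) :=
  if choice.unpickle n is Some q then (if mu (B q) == 0%E then B q else set0) else set0.
apply: (@negligibleS _ _ _ mu (\bigcup_n F n)); last first.
  apply: negligible_bigcup => n; rewrite /F; case: choice.unpickle => [q|].
    case: ifPn => [/eqP q0|_]; last exact: negligible_set0.
    by exists (B q); split => //; exact: mB.
  exact: negligible_set0.
move=> x /= nx.
have [U [oU Ux U0]] : exists U : set 'rV[R]_d, [/\ open U, U x & mu U = 0%E].
  apply: contrapT => h; apply: nx => U oU Ux.
  rewrite lt0e measure_ge0 andbT; apply/eqP => U0; apply: h.
  by exists U.
have /nbhs_ballP[e /= e0 xU] : nbhs x U by exact: open_nbhs_nbhs.
pose k := Num.truncn (2 / e).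
have k0 : 0 < (k.+1%:R : R) by rewrite ltr0n.
have ke : 2 * k.+1%:R^-1 < e.
  rewrite ltr_pdivrMr// mulrC -ltr_pdivrMr//.
  by have /truncn_itv/andP[] : 0 <= 2 / e by rewrite divr_ge0// ltW.
have /choice[q Hq] : forall j : 'I_d, exists q : rat,
    `|ratr q - x ord0 j| < (k.+1%:R^-1 : R).
  move=> j; have : x ord0 j - k.+1%:R^-1 < x ord0 j + k.+1%:R^-1.
    by rewrite ltrBlDr -addrA ltrDl addr_gt0// invr_gt0.
  move=> /rat_in_itvoo[q]; rewrite in_itv/= => /andP[q1 q2]; exists q.
  by rewrite ltr_norml; apply/andP; split; [rewrite ltrBrDl; exact: q1|rewrite ltrBlDl; exact: q2].
pose c : 'rV[rat]_d := \row_j q j.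
have xB : B (c, k) x.
  split; first by rewrite invr_gt0.
  by move=> i j; rewrite /ball/= !mxE ord1; exact: Hq.
have BU : B (c, k) `<=` U.
  move=> y [_ yB]; apply: xU; split => // i j; have := yB i j.
  case: xB => _ /(_ i j); rewrite /ball/= => h1 h2.
  rewrite -(subrKA (map_mx ratr c i j)).
  apply: (le_lt_trans (ler_normD _ _)); apply: lt_trans ke.
  rewrite mulr_natl mulr2n ltrD//.
  by rewrite distrC.
exists (choice.pickle (c, k)) => //; rewrite /F choice.pickleK.
case: ifPn => // /negP[]; rewrite -measure_le0.
apply: (@le_trans _ _ (mu U)); last by rewrite U0.
have mU : measurable (U : set (borel_rV R d)) by exact: sub_sigma_algebra.
exact: (le_measure mu (mem_set (mB (c, k))) (mem_set mU) BU).
Qed.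

Section compact_norm.
Context {R : realType} {d : nat} (rho : 'rV[R]_d -> R).
Hypothesis hrho : is_norm rho.

Lemma open_norm_ball a e : open [set x : 'rV[R]_d | rho (x - a) < e].
Proof.
have -> : [set x : 'rV[R]_d | rho (x - a) < e] =
  (fun x => rho (x - a)) @^-1` [set t | t < e] by [].
apply: open_comp; last exact: open_lt.
by move=> x _; exact: is_norm_dist_continuous.
Qed.

Lemma compact_net (K : set 'rV[R]_d) e : compact K -> 0 < e ->
  exists s : seq 'rV[R]_d, (forall a, a \in s -> K a) /\
    forall x, K x -> exists2 a, a \in s & rho (x - a) < e.
Proof.
rewrite compact_cover => cK e0.
have [||s sK Ks] := cK _ K (fun a => [set x | rho (x - a) < e]).
- by move=> a _; exact: open_norm_ball.
- by move=> x Kx; exists x; rewrite //= subrr is_norm0.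
exists (finmap.enum_fset s); split=> [a /sK/set_mem//|x /Ks[a /= as_ xa]].
by exists a.
Qed.

(** A nearest point [b] of [K] satisfies [rho (a - b) <= rho (x - a)] for
   all [x] in [K]. *)
Lemma nearest_point (K : set 'rV[R]_d) a : compact K -> K !=set0 ->
  exists2 b, K b & forall x, K x -> rho (x - b) <= 2 * rho (x - a).
Proof.
move=> cK K0.
have [|b /set_mem Kb bmin] := @EVT_min_rV _ _ (fun x => rho (x - a)) _ K0 cK.
  by apply: continuous_subspaceT; exact: is_norm_dist_continuous.
exists b => // x Kx; apply: (le_trans (is_norm_distD _ hrho a _ _)).
rewrite mulr_natl mulr2n lerD2l is_norm_distC//.
by apply: bmin; rewrite inE.
Qed.

Lemma compact_disjoint_gap (A B : set 'rV[R]_d) : compact A -> compact B ->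
  A `&` B = set0 ->
  exists2 e, 0 < e & forall x y, A x -> B y -> e <= rho (x - y).
Proof.
move=> cA cB AB.
have [AB0|nAB] := pselect (A `*` B !=set0); last first.
  by exists 1 => // x y Ax By; exfalso; apply: nAB; exists (x, y).
have [|[u v] /set_mem[/= Au Bv] uvmin] := @compact_EVT_min _ _
    (fun z : 'rV[R]_d * 'rV[R]_d => rho (z.1 - z.2)) _ AB0 (compact_setX cA cB).
  apply: continuous_subspaceT => z.
  apply: continuous_comp; last exact: is_norm_continuous.
  exact: sub_continuous.
exists (rho (u - v)); last first.
  by move=> x y Ax By; apply: (uvmin (x, y)); rewrite inE.
rewrite lt0r is_norm_ge0// andbT; apply/eqP; case: hrho => _ _ /[apply] /eqP.
rewrite subr_eq0 => /eqP uv; suff : (A `&` B) u by rewrite AB.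
by split=> //; rewrite uv.
Qed.

Variable mu : probability (borel_rV R d) R.

(** Every ball of radius [e] centred in the support contains one of finitely
   many balls of radius [e / 2] centred in the support, which have positive mass. *)
Lemma compact_ball_mass e : compact (msupport mu) -> 0 < e ->
  exists2 c, 0 < c & forall x, msupport mu x ->
    (c%:E <= mu [set y | (rho (y - x) < e)%R])%E.
Proof.
move=> cK e0; have e20 : 0 < e / 2 by rewrite divr_gt0.
have mb a u : measurable ([set y | rho (y - a) < u] : set (borel_rV R d)).
  by apply: sub_sigma_algebra; exact: open_norm_ball.
have [s [sK Ks]] := compact_net _ _ cK e20.
have [|a /sK Ka|c c0 hc] := @exists_uniform_pos R _ s
    (fun a c => (c%:E <= mu [set y | (rho (y - a) < e / 2)%R])%E).
- by move=> a c c' cc'; apply: le_trans; rewrite lee_fin.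
- have := Ka _ (open_norm_ball a (e / 2)); rewrite /= subrr is_norm0// => /(_ e20).
  have /fineK <- := fin_num_measure mu _ (mb a (e / 2)).
  by rewrite lte_fin => h; exists (fine (mu [set y | rho (y - a) < e / 2])).
exists c => // x /Ks[a /hc ca xa]; apply: (le_trans ca).
apply: (le_measure mu (mem_set (mb _ _)) (mem_set (mb _ _))).
move=> y /= ya; apply: (le_lt_trans (is_norm_distD _ hrho a _ _)).
by rewrite (splitr e) ltrD// is_norm_distC.
Qed.

End compact_norm.

(** * Estimates of the cost *)

(** Only the values on the support matter, since its complement is null. *)
Lemma le_integral_msupport (R : realType) (d : nat)
    (mu : probability (borel_rV R d) R) (h1 h2 : borel_rV R d -> \bar R) :
  (forall x, (0 <= h1 x)%E) -> (forall x, (0 <= h2 x)%E) ->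
  measurable_fun setT h1 -> measurable_fun setT h2 ->
  (forall x, msupport mu x -> (h1 x <= h2 x)%E) ->
  (\int[mu]_x h1 x <= \int[mu]_x h2 x)%E.
Proof.
move=> h10 h20 m1 m2 h12; apply: ae_ge0_le_integral => //.
apply: (negligibleS _ (msupport_ae _ _ mu)) => x /= nx sx; apply: nx => _.
exact: h12.
Qed.

Section cost_estimates.
Context {R : realType} {d : nat} (rho : 'rV[R]_d -> R) (r : R).
Hypotheses (hrho : is_norm rho) (r0 : 0 < r).
Variable mu : probability (borel_rV R d) R.
Implicit Types s : seq 'rV[R]_d.
Local Notation cost := (cost rho r).

Lemma seq_set_nonempty s : s != [::] -> [set` s] !=set0.
Proof. by case: s => // a s _; exists a; rewrite /= mem_head. Qed.

Lemma scaled_cost k s : s != [::] -> 0 <= k ->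
  (\int[mu]_x ((k * dist_set rho x [set` s]) `^ r)%:E = (k `^ r)%:E * cost mu s)%E.
Proof.
move=> s0 k0; rewrite -ge0_integralZl//.
- apply: eq_integral => x _; rewrite -EFinM powRM// dist_set_ge0//.
  exact: seq_set_nonempty.
- exact: measurable_dist_powR.
- by move=> x _; rewrite lee_fin powR_ge0.
- by rewrite lee_fin powR_ge0.
Qed.

Lemma cost_le_radius s t : s != [::] ->
  (forall x, msupport mu x -> dist_set rho x [set` s] <= t) ->
  (cost mu s <= (t `^ r)%:E)%E.
Proof.
move=> s0 h; rewrite -[leRHS]mule1 -(@probability_setT _ _ _ mu) -integral_cst//.
apply: le_integral_msupport => //.
- by move=> x; rewrite lee_fin powR_ge0.
- by move=> x; rewrite lee_fin powR_ge0.
- exact: measurable_dist_powR.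
- move=> x /h xt; rewrite lee_fin ge0_ler_powR ?nnegrE ?(ltW r0)//.
    by rewrite dist_set_ge0//; exact: seq_set_nonempty.
  by apply: le_trans xt; rewrite dist_set_ge0//; exact: seq_set_nonempty.
Qed.

(** The points at distance less than [e / 2] from [x] are at distance at least
   [e / 2] from the centres. *)
Lemma cost_ge_ball_mass s x e : s != [::] -> 0 < e ->
  e <= dist_set rho x [set` s] ->
  (((e / 2) `^ r)%:E * mu [set y | (rho (y - x) < e / 2)%R] <= cost mu s)%E.
Proof.
move=> s0 e0 ex.
have mB : measurable ([set y | (rho (y - x) < e / 2)%R] : set (borel_rV R d)).
  by apply: sub_sigma_algebra; exact: open_norm_ball.
have mh := measurable_dist_powR _ hrho r _ s0.
rewrite -integral_cst//.
apply: (@le_trans _ _ (\int[mu]_(y in [set y | (rho (y - x) < e / 2)%R])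
    ((dist_set rho y [set` s]) `^ r)%:E)%E); last first.
  apply: ge0_subset_integral => //.
  by move=> y _; rewrite lee_fin powR_ge0.
apply: ge0_le_integral => //.
- by move=> y _; rewrite lee_fin powR_ge0.
- exact: measurable_funTS.
- move=> y /= yx; rewrite lee_fin.
  have ey : e / 2 <= dist_set rho y [set` s].
    have := dist_set_seq_lipschitz _ hrho x y _ s0.
    rewrite is_norm_distC// => H; rewrite (splitr e) in ex; lra.
  rewrite ge0_ler_powR ?nnegrE ?(ltW r0)//; first by rewrite divr_ge0 ?(ltW e0).
  by apply: le_trans ey; rewrite divr_ge0 ?(ltW e0).
Qed.

(** A finite net of the support of mesh [t] has cost at most [t ^ r]. *)
Lemma quant_error_vanishing : compact (msupport mu) -> msupport mu !=set0 ->
  vanishing (quant_error rho r mu).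
Proof.
move=> cK [x0 Kx0] e e0; pose t := (e / 2) `^ r^-1.
have t0 : 0 < t by rewrite powR_gt0// divr_gt0.
have [s [sK Ks]] := compact_net _ hrho _ _ cK t0.
have s0 : s != [::] by apply/eqP => s0; have [a] := Ks _ Kx0; rewrite s0.
exists (size s) => // n /= sn; apply: (@le_lt_trans _ _ (t `^ r)%:E).
  apply: le_trans (quant_error_le_cost _ _ _ _ _ s0 sn) _.
  apply: cost_le_radius => // x /Ks[a sa /ltW]; apply: le_trans.
  exact: dist_set_le.
rewrite lte_fin /t -powRrM mulVf ?gt_eqF// powRr1 ?divr_ge0 ?ltW//.
by rewrite ltr_pdivrMr// ltr_pMr// ltr1n.
Qed.

(** Moving every centre to a nearest point of the support at most doubles its
   distances from the points of the support. *)
Lemma cost_ge_of_centres_in_support (c : R) n :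
  compact (msupport mu) -> msupport mu !=set0 ->
  (forall s, s != [::] -> (size s <= n)%N -> (forall a, a \in s -> msupport mu a) ->
     (c%:E <= cost mu s)%E) ->
  ((c / 2 `^ r)%:E <= quant_error rho r mu n)%E.
Proof.
move=> cK K0 h; apply: quant_error_ge => s s0 sn.
have /choice[g Hg] : forall a, exists b, msupport mu b /\
    forall x, msupport mu x -> rho (x - b) <= 2 * rho (x - a).
  by move=> a; have [b Kb Hb] := nearest_point _ hrho _ a cK K0; exists b.
have gs0 : map g s != [::] by case: s s0 {sn}.
have gsn : (size (map g s) <= n)%N by rewrite size_map.
have {h} := h _ gs0 gsn.
have -> : (forall a, a \in map g s -> msupport mu a) = True.
  by apply/propext; split=> // _ a /mapP[b _ ->]; case: (Hg b).
move=> /(_ Logic.I) h.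
rewrite -(@lee_pmul2l _ (2 `^ r)%:E) ?lte_fin ?powR_gt0//.
rewrite -EFinM mulrC divfK ?gt_eqF ?powR_gt0// (le_trans h)//.
rewrite -scaled_cost//; apply: le_integral_msupport.
- by move=> x; rewrite lee_fin powR_ge0.
- by move=> x; rewrite lee_fin powR_ge0.
- exact: measurable_dist_powR.
- exact: measurable_scaled_dist_powR.
- move=> x Kx; have [a sa Ea] := dist_set_seq_attained _ hrho x _ s0.
  have gle : dist_set rho x [set` map g s] <= 2 * dist_set rho x [set` s].
    rewrite Ea; have [_ /(_ x Kx)] := Hg a; apply: le_trans.
    by apply: dist_set_le => //=; exact: map_f.
  have d0 := dist_set_ge0 _ hrho x _ (seq_set_nonempty _ gs0).
  by rewrite lee_fin ge0_ler_powR ?nnegrE ?(ltW r0)// (le_trans d0).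
Qed.

End cost_estimates.

Lemma cost_condensation {R : realType} {d N : nat} (rho : 'rV[R]_d -> R) (r : R)
    (hrho : is_norm rho) (f : 'I_N -> 'rV[R]_d -> 'rV[R]_d) (p0 : R) (p : 'I_N -> R)
    (nu mu : probability (borel_rV R d) R) (s : seq 'rV[R]_d) :
  (forall i, continuous (f i)) -> 0 <= p0 -> (forall i, 0 <= p i) ->
  (forall A : set (borel_rV R d), measurable A ->
    mu A = (\sum_i (p i)%:E * mu (f i @^-1` A) + p0%:E * nu A)%E) ->
  s != [::] ->
  cost rho r mu s = (\sum_i (p i)%:E *
      (\int[mu]_x ((dist_set rho (f i x) [set` s]) `^ r)%:E) +
    p0%:E * cost rho r nu s)%E.
Proof.
move=> cf p00 pp muE s0; rewrite /cost (integral_condensation _ _ _ f p0 p nu mu)//.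
- by move=> x; rewrite lee_fin powR_ge0.
- exact: measurable_dist_powR.
Qed.

(** * The lower recursion *)

(** Each entry of [s] is counted for at most one [i]. *)
Lemma sum_count_le_size (T : Type) (I : finType) (P : I -> pred T) (s : seq T) :
  (forall x i j, P i x -> P j x -> i = j) ->
  (\sum_i count (P i) s <= size s)%N.
Proof.
move=> Pdisj; elim: s => [|x s IH]; first by rewrite big1.
rewrite /= big_split/= -add1n leq_add//.
have [i Pi|nP] := pickP (fun i => P i x); last by rewrite big1// => i _; rewrite nP.
rewrite (bigD1 i)//= big1 ?addn0 ?leq_b1// => j ji.
by apply/eqP; rewrite eqb0; apply: contra ji => Pj; rewrite (Pdisj _ _ _ Pi Pj).
Qed.

Section lower_recursion.
Context {R : realType} {d N : nat} (rho : 'rV[R]_d -> R) (r : R)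
  (f : 'I_N -> 'rV[R]_d -> 'rV[R]_d) (a : 'I_N -> R) (p0 : R) (p : 'I_N -> R)
  (C : set 'rV[R]_d) (nu mu : probability (borel_rV R d) R).
Hypotheses (hrho : is_norm rho) (r0 : 0 < r) (a0 : forall i, 0 < a i)
  (fa : forall i x y, a i * rho (x - y) <= rho (f i x - f i y))
  (cf : forall i, continuous (f i))
  (p00 : 0 < p0) (pp : forall i, 0 < p i)
  (cK : compact (msupport mu)) (cC : compact C) (C0 : C !=set0)
  (KE : msupport mu = (\bigcup_i (f i @` msupport mu)) `|` C)
  (hssc : condensation_ssc f C (msupport mu))
  (muE : forall A : set (borel_rV R d), measurable A ->
    mu A = (\sum_i (p i)%:E * mu (f i @^-1` A) + p0%:E * nu A)%E).
Implicit Types s : seq 'rV[R]_d.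
Local Notation K := (msupport mu).
Local Notation cost := (cost rho r).

Let piece (o : option 'I_N) : set 'rV[R]_d :=
  if o is Some i then f i @` K else C.

Let piece_disjoint o o' : o != o' -> piece o `&` piece o' = set0.
Proof.
case: hssc => ff fC; case: o o' => [i|] [j|] //=.
- by move=> ij; apply: ff; apply: contraNneq ij => ->.
- by rewrite setIC.
Qed.

Let piece_in o x : piece o x -> K x.
Proof.
by case: o => [i|] h; rewrite KE; [left; exists i|right].
Qed.

Let in_piece x : K x -> exists o, piece o x.
Proof.
by rewrite {1}KE => -[[i _ h]|h]; [exists (Some i)|exists None].
Qed.

Let piece_gap : exists2 e, 0 < e & forall o o' x y, o != o' ->
  piece o x -> piece o' y -> e <= rho (x - y).
Proof.
have cpiece o : compact (piece o).
  case: o => [i|//]; apply: continuous_compact => //.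
  exact: continuous_subspaceT.
have [||e e0 he] := @exists_uniform_pos R _ (enum {: option 'I_N * option 'I_N})
  (fun pr e => pr.1 != pr.2 -> forall x y, piece pr.1 x -> piece pr.2 y ->
     e <= rho (x - y)).
- by move=> z v v' vv' h zz x y hx hy; apply: (le_trans vv'); exact: h.
- case=> o o' _ /=; have [->|pr'] := eqVneq o o'; first by exists 1.
  have [e e0 he] := compact_disjoint_gap _ hrho _ _ (cpiece o) (cpiece o')
    (piece_disjoint _ _ pr').
  by exists e => // _ x y; exact: he.
by exists e => // o o' x y pr'; apply: (he (o, o')); rewrite ?mem_enum.
Qed.

Let measurable_dist_powR_comp i s : s != [::] -> measurable_fun [set: borel_rV R d]
  ((fun x => ((dist_set rho (f i x) [set` s]) `^ r)%:E) : borel_rV R d -> \bar R).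
Proof.
move=> s0; apply: (measurableT_comp (measurable_dist_powR _ hrho r _ s0)).
exact: continuous_measurable_map.
Qed.

Lemma quant_error_ge_condensation n :
  (p0%:E * quant_error rho r nu n <= quant_error rho r mu n)%E.
Proof.
apply: quant_error_ge => s s0 sn; rewrite (cost_condensation _ _ hrho f p0 p nu mu _ cf (ltW p00)
  (fun i => ltW (pp i)) muE)//.
apply: (@le_trans _ _ (p0%:E * cost nu s)%E).
  by rewrite lee_pmul2l ?lte_fin// quant_error_le_cost.
rewrite leeDr// sume_ge0// => i _; rewrite mule_ge0 ?lee_fin ?(ltW (pp i))//.
by apply: integral_ge0 => x _; rewrite lee_fin powR_ge0.
Qed.

(** Strong induction on the number of centres. The distinction is whether some
   point of the support is far from all the centres: this bounds the cost below
   by a constant, and otherwise the centres split between the pieces. *)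
Lemma cost_lower_bound (s : R) : 0 < s -> (0 < N)%N ->
  \sum_i (p i * a i `^ r) `^ (s / (r + s)) = 1 ->
  exists2 c, 0 < c & forall sq, sq != [::] -> (forall y, y \in sq -> K y) ->
    ((c * (size sq)%:R `^ (- (r / s)))%:E <= cost mu sq)%E.
Proof.
move=> s0 N0 st1; have q0 : 0 < r / s by rewrite divr_gt0.
have [e e0 gap] := piece_gap.
have e20 : 0 < e / 2 by rewrite divr_gt0.
have [m m0 hm] := compact_ball_mass _ hrho _ _ cK e20.
have c0 : 0 < (e / 2) `^ r * m by rewrite mulr_gt0 ?powR_gt0.
exists ((e / 2) `^ r * m) => // sq.
have [n] := ubnP (size sq); elim: n sq => // n IH sq; rewrite ltnS => sqn sq0 sqK.
have szp : (0 < size sq)%N by rewrite lt0n size_eq0.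
have [[x [Kx xe]]|near_sq] :=
    pselect (exists x, K x /\ e <= dist_set rho x [set` sq]).
  apply: le_trans (cost_ge_ball_mass _ _ hrho r0 mu _ _ _ sq0 e0 xe).
  apply: (@le_trans _ _ ((e / 2) `^ r * m)%:E).
    rewrite lee_fin ler_piMr ?(ltW c0)// powRN invf_le1 ?powR_gt0 ?ltr0n//.
    by rewrite -[leLHS](powRr0 (size sq)%:R) ler_powR ?ler1n// ltW.
  by rewrite EFinM lee_pmul2l ?lte_fin ?powR_gt0// hm.
pose P o y := `[< piece o y >].
have Pdisj y o o' : P o y -> P o' y -> o = o'.
  move=> /asboolP h /asboolP h'; apply/eqP; apply: contrapT => /negP pr'.
  by suff : (piece o `&` piece o') y by rewrite piece_disjoint.
have nearest o x : piece o x -> exists y, [/\ y \in sq, P o y &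
    dist_set rho x [set` sq] = rho (x - y)].
  move=> ox; have [y ysq Ey] := dist_set_seq_attained _ hrho x _ sq0.
  exists y; split => //; have [k ky] := in_piece _ (sqK _ ysq).
  have [-> //|pr'] := eqVneq o k; first exact/asboolP.
  exfalso; apply: near_sq; exists x; split; first exact: piece_in ox.
  by rewrite Ey; exact: gap pr' _ _.
have [u Cu] := C0.
have [x1 Kx1] : K !=set0 by exists u; apply: (piece_in None).
(* The list t i consists of the preimages under f i of the centres in f_i(K). *)
pose g i y := xget 0 [set x | K x /\ f i x = y].
have gP i y : P (Some i) y -> K (g i y) /\ f i (g i y) = y.
  move=> /asboolP[z Kz zy].
  by apply: (@xgetPex _ 0 [set x | K x /\ f i x = y]); exists z.
pose t i := [seq g i y | y <- sq & P (Some i) y].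
have tK i y : y \in t i -> K y.
  by case/mapP => z; rewrite mem_filter => /andP[/gP[+ _] _] ->.
have t0 i : t i != [::].
  have [y [ysq Py _]] := nearest (Some i) (f i x1) (ex_intro2 _ _ x1 Kx1 erefl).
  rewrite -size_eq0 size_map size_filter -lt0n -has_count.
  by apply/hasP; exists y.
(* The inequality is strict because C also contains a centre. *)
have szt : (\sum_i size (t i) < size sq)%N.
  apply: leq_trans (sum_count_le_size _ _ P sq Pdisj).
  have [y [ysq Py _]] := nearest None u Cu.
  rewrite (bigD1 None)//= -add1n leq_add//.
    by rewrite -has_count; apply/hasP; exists y.
  rewrite [leqRHS](reindex_onto (@Some 'I_N) (fun o => odflt (Ordinal N0) o))/=.
    by rewrite leq_eqVlt; apply/orP; left; apply/eqP; apply: eq_big => [i|i _];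
      rewrite ?eqxx// /t size_map size_filter.
  by case.
have cost_ge i : ((a i `^ r)%:E * cost mu (t i) <=
    \int[mu]_x ((dist_set rho (f i x) [set` sq]) `^ r)%:E)%E.
  rewrite -scaled_cost ?(ltW (a0 i))//; apply: le_integral_msupport.
  - by move=> x; rewrite lee_fin powR_ge0.
  - by move=> x; rewrite lee_fin powR_ge0.
  - exact: measurable_scaled_dist_powR.
  - exact: measurable_dist_powR_comp.
  - move=> x Kx; have [y [ysq Py Ey]] :=
      nearest (Some i) (f i x) (ex_intro2 _ _ x Kx erefl).
    have [Kg gy] := gP _ _ Py.
    have tx0 := dist_set_ge0 _ hrho x _ (seq_set_nonempty _ (t0 i)).
    rewrite lee_fin ge0_ler_powR ?(ltW r0) ?nnegrE ?mulr_ge0 ?(ltW (a0 i))//.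
      by rewrite Ey is_norm_ge0.
    rewrite Ey -{1}gy (le_trans _ (fa _ _ _))// ler_pM2l//.
    by apply: dist_set_le => //=; apply: map_f; rewrite mem_filter Py.
set c := _ * m.
pose w i := (p i * a i `^ r) `^ (s / (r + s)).
have w0 i : 0 < w i by rewrite powR_gt0// mulr_gt0 ?powR_gt0.
(* The exponents s/(r+s) and 1 + r/s are inverse to each other. *)
have wE i : p i * a i `^ r = w i `^ (1 + r / s).
  have E : s / (r + s) * (1 + r / s) = 1 by field; rewrite !gt_eqF// addr_gt0.
  rewrite /w -powRrM E.
  by rewrite powRr1// mulr_ge0 ?powR_ge0// ltW.
have szt0 i : 0 < ((size (t i))%:R : R) by rewrite ltr0n lt0n size_eq0.
have jensen := sum_powR_jensen _ _ w (fun i => (size (t i))%:R) _ q0 N0 w0 st1 szt0.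
rewrite (cost_condensation _ _ hrho f p0 p nu mu _ cf (ltW p00)
  (fun i => ltW (pp i)) muE)//.
apply: (@le_trans _ _ (\sum_i (p i)%:E *
    ((a i `^ r)%:E * (c * (size (t i))%:R `^ (- (r / s)))%:E))%E).
  under eq_bigr do rewrite -!EFinM.
  rewrite sumEFin lee_fin.
  apply: (@le_trans _ _ (c * \sum_i w i `^ (1 + r / s) *
      (size (t i))%:R `^ (- (r / s)))); last first.
    rewrite mulr_sumr le_eqVlt; apply/orP; left; apply/eqP; apply: eq_bigr => i _.
    by rewrite -wE; ring.
  rewrite ler_pM2l//; apply: le_trans jensen.
  rewrite -natr_sum !powRN lef_pV2 ?posrE ?powR_gt0 ?ltr0n//; last first.
    by rewrite (bigD1 (Ordinal N0))//= addn_gt0 lt0n size_eq0 t0.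
  by rewrite ge0_ler_powR ?(ltW q0) ?nnegrE ?ler0n// ler_nat ltnW.
rewrite -[leLHS]adde0; apply: leeD; last first.
  by rewrite mule_ge0 ?cost_ge0// lee_fin ltW.
apply: lee_sum => i _; rewrite lee_pmul2l ?lte_fin//.
apply: le_trans (cost_ge i); rewrite lee_pmul2l ?lte_fin ?powR_gt0//.
apply: IH => //; last exact: tK.
apply: leq_trans sqn; apply: leq_ltn_trans szt.
by rewrite (bigD1 i)//= leq_addr.
Qed.

End lower_recursion.

(** * The upper recursion *)

Section upper_recursion.
Context {R : realType} {d N : nat} (rho : 'rV[R]_d -> R) (r : R)
  (f : 'I_N -> 'rV[R]_d -> 'rV[R]_d) (b : 'I_N -> R) (p0 : R) (p : 'I_N -> R)
  (nu mu : probability (borel_rV R d) R).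
Hypotheses (hrho : is_norm rho) (r0 : 0 < r) (b0 : forall i, 0 < b i)
  (fb : forall i x y, rho (f i x - f i y) <= b i * rho (x - y))
  (p00 : 0 < p0) (pp : forall i, 0 < p i)
  (cK : compact (msupport mu)) (K0 : msupport mu !=set0)
  (muE : forall A : set (borel_rV R d), measurable A ->
    mu A = (\sum_i (p i)%:E * mu (f i @^-1` A) + p0%:E * nu A)%E).
Implicit Types s : seq 'rV[R]_d.
Local Notation cost := (cost rho r).

Let cf i : continuous (f i).
Proof. by apply: lipschitz_map_continuous (fb i); rewrite ?(ltW (b0 i)). Qed.

(** The images under [f i] of centres for [mu] serve the i-th summand of the
   cost, and [sq0] serves the summand of [nu]. *)
Lemma cost_union_le (sq : 'I_N -> seq 'rV[R]_d) sq0 :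
  (forall i, sq i != [::]) -> sq0 != [::] ->
  (cost mu (sq0 ++ flatten [seq map (f i) (sq i) | i <- enum 'I_N]) <=
   \sum_i (p i)%:E * ((b i `^ r)%:E * cost mu (sq i)) + p0%:E * cost nu sq0)%E.
Proof.
move=> sqn sq0n; set u := sq0 ++ _.
have un : u != [::] by rewrite /u; case: sq0 sq0n {u}.
rewrite (cost_condensation _ _ hrho f p0 p nu mu _ cf (ltW p00)
  (fun i => ltW (pp i)) muE un).
apply: leeD.
  apply: lee_sum => i _; apply: lee_wpmul2l; first by rewrite lee_fin ltW.
  rewrite -(scaled_cost _ _ hrho mu _ _ (sqn i) (ltW (b0 i))).
  apply: le_integral_msupport.
  - by move=> x; rewrite lee_fin powR_ge0.
  - by move=> x; rewrite lee_fin powR_ge0.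
  - apply: (measurableT_comp (measurable_dist_powR _ hrho r _ un)).
    exact: continuous_measurable_map.
  - exact: measurable_scaled_dist_powR.
  - move=> x _; have [y ysq Ey] := dist_set_seq_attained _ hrho x _ (sqn i).
    have d0 := dist_set_ge0 _ hrho (f i x) _ (seq_set_nonempty _ un).
    have dle : dist_set rho (f i x) [set` u] <= b i * dist_set rho x [set` sq i].
      rewrite Ey; apply: le_trans (fb i x y); apply: dist_set_le => //=.
      rewrite mem_cat; apply/orP; right; apply/flattenP.
      exists (map (f i) (sq i)); last exact: map_f.
      by apply: (map_f (fun i => map (f i) (sq i))); rewrite mem_enum.
    by rewrite lee_fin ge0_ler_powR ?(ltW r0) ?nnegrE// (le_trans d0).
apply: lee_wpmul2l; first by rewrite lee_fin ltW.
apply: le_integral_msupport.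
- by move=> x; rewrite lee_fin powR_ge0.
- by move=> x; rewrite lee_fin powR_ge0.
- exact: measurable_dist_powR.
- exact: measurable_dist_powR.
- move=> x _; have [y ysq Ey] := dist_set_seq_attained _ hrho x _ sq0n.
  have d0 := dist_set_ge0 _ hrho x _ (seq_set_nonempty _ un).
  have dle : dist_set rho x [set` u] <= dist_set rho x [set` sq0].
    by rewrite Ey; apply: dist_set_le => //=; rewrite mem_cat ysq.
  by rewrite lee_fin ge0_ler_powR ?(ltW r0) ?nnegrE// (le_trans d0).
Qed.

Lemma nat_just_above (x : R) : 0 <= x ->
  exists k : nat, [/\ (0 < k)%N, x < k%:R & k%:R <= x + 1].
Proof.
move=> /truncn_itv/andP[h1 h2]; exists (Num.truncn x).+1; split => //.
by rewrite -natr1 lerD2r.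
Qed.

(** Strong induction on [n]: the share of the i-th copy of [mu] is about
   [t i * n] centres, with [t i = (p i * b i^r)^(s/(r+s))], and that of [nu]
   about [e * n]. The constant [c1] absorbs the contribution of [nu], and [c2]
   covers the finitely many [n] below the threshold [n1]. *)
Lemma quant_error_upper_bound (s : R) : 0 < s ->
  \sum_i (p i * b i `^ r) `^ (s / (r + s)) < 1 ->
  (\forall n \near \oo,
     (quant_error rho r nu n <= (n%:R `^ (- (r / s)))%:E)%E) ->
  exists2 c, 0 < c & forall n, (0 < n)%N ->
    (quant_error rho r mu n <= (c * n%:R `^ (- (r / s)))%:E)%E.
Proof.
move=> s0 tau1 [nnu _ Hnu]; have q0 : 0 < r / s by rewrite divr_gt0.
set q := r / s in q0 *.
pose t i := (p i * b i `^ r) `^ (s / (r + s)).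
have t0 i : 0 < t i by rewrite powR_gt0// mulr_gt0 ?powR_gt0.
have tE i : p i * b i `^ r = t i * t i `^ q.
  have E : s / (r + s) * (1 + r / s) = 1 by field; rewrite !gt_eqF// addr_gt0.
  rewrite -{1}[t i]powRr1 ?(ltW (t0 i))// -powRD ?(gt_eqF (t0 i)) ?implybT//.
  by rewrite /t -powRrM E powRr1// mulr_ge0 ?powR_ge0// ltW.
set tau := \sum_i t i; rewrite -/tau in tau1.
(* Half of the slack goes to nu, the other half pays for rounding up. *)
pose e := (1 - tau) / 2.
have e0 : 0 < e by rewrite divr_gt0// subr_gt0.
have eE : tau = 1 - 2 * e by rewrite /e; field.
have [n1 [n10 n1l _]] := nat_just_above _ (divr_ge0 (ler0n R (N + nnu + 1)) (ltW e0)).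
have n1P n : (n1 <= n)%N -> (N + nnu + 1)%:R <= e * n%:R.
  move=> n1n; rewrite mulrC -ler_pdivrMr//; apply: ltW.
  by apply: (lt_le_trans n1l); rewrite ler_nat.
have [x0 Kx0] := K0.
have [T T0 HT] : exists2 T, 0 < T & forall x, msupport mu x -> rho (x - x0) <= T.
  have [|z _ zmax] := @EVT_max_rV _ _ (fun x => rho (x - x0)) _ K0 cK.
    by apply: continuous_subspaceT; exact: is_norm_dist_continuous.
  exists (rho (z - x0) + 1); first by rewrite ltr_wpDl// is_norm_ge0.
  by move=> x Kx; rewrite (le_trans (zmax x _)) ?lerDl// inE.
pose c1 := p0 * 2 * e `^ (- q) / (1 - tau).
pose c2 := T `^ r * n1%:R `^ q.
have tau1' : 0 < 1 - tau by rewrite subr_gt0.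
have c10 : 0 < c1 by rewrite !mulr_gt0 ?invr_gt0 ?powR_gt0.
have c20 : 0 < c2 by rewrite mulr_gt0 ?powR_gt0 ?ltr0n.
exists (c1 + c2); first by rewrite addr_gt0.
set c := c1 + c2; have c0 : 0 < c by rewrite addr_gt0.
suff H n : (0 < n)%N -> exists sq, [/\ sq != [::], (size sq <= n)%N &
    (cost mu sq <= (c * n%:R `^ (- q))%:E)%E].
  move=> n /H[sq [sq0 sqn]]; apply: le_trans.
  exact: quant_error_le_cost.
have [k] := ubnP n; elim: k n => // k IH n; rewrite ltnS => nk n0.
have n0R : 0 < (n%:R : R) by rewrite ltr0n.
have [nn1|n1n] := ltnP n n1.
  exists [:: x0]; split => //; apply: (@le_trans _ _ (T `^ r)%:E).
    apply: cost_le_radius => // x /HT; apply: le_trans.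
    by apply: dist_set_le; rewrite //= mem_head.
  rewrite lee_fin powRN ler_pdivlMr ?powR_gt0//.
  apply: (@le_trans _ _ c2); last by rewrite lerDr ltW.
  rewrite ler_pM2l ?powR_gt0// ge0_ler_powR ?(ltW q0) ?nnegrE ?ler0n//.
  by rewrite ler_nat ltnW.
have en := n1P _ n1n.
have /choice[m mP] i : exists k : nat,
    [/\ (0 < k)%N, t i * n%:R < k%:R & k%:R <= t i * n%:R + 1].
  by apply: nat_just_above; rewrite mulr_ge0 ?(ltW (t0 i)).
have [m0 [m00 m0l m0u]] := nat_just_above _ (mulr_ge0 (ltW e0) (ler0n R n)).
have sum_m : (\sum_i m i + m0 <= n)%N.
  rewrite -(ler_nat R) natrD natr_sum.
  apply: (@le_trans _ _ (\sum_i (t i * n%:R + 1) + (e * n%:R + 1))).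
    by apply: lerD => //; apply: ler_sum => i _; case: (mP i).
  rewrite big_split/= -mulr_suml -/tau sumr_const card_ord eE.
  move: en; rewrite !natrD => en.
  have : 0 <= (nnu%:R : R) by [].
  by rewrite -[1 *+ N]/(N%:R); lra.
have mn i : (m i < n)%N.
  apply: leq_trans sum_m; rewrite (bigD1 i)//= -addnA -addn1 leq_add2l.
  by rewrite addn_gt0 m00 orbT.
have /choice[sq Hsq] i : exists sq, [/\ sq != [::], (size sq <= m i)%N &
    (cost mu sq <= (c * (m i)%:R `^ (- q))%:E)%E].
  by apply: IH; [exact: leq_trans (mn i) nk|case: (mP i)].
(* The factor 2 allows for the infimum in the error of nu not being attained. *)
have [sq0 [sq0n sq0s sq0c]] : exists sq0, [/\ sq0 != [::], (size sq0 <= m0)%N &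
    (cost nu sq0 < (2 * m0%:R `^ (- q))%:E)%E].
  apply: quant_error_lt; apply: le_lt_trans (Hnu m0 _) _ => /=.
    rewrite -(ler_nat R); apply: ltW; apply: le_lt_trans m0l.
    apply: le_trans en; rewrite ler_nat -addnA addnCA leq_addr//.
  by rewrite lte_fin ltr_pMl ?powR_gt0 ?ltr0n// ltr1n.
exists (sq0 ++ flatten [seq map (f i) (sq i) | i <- enum 'I_N]); split.
- by case: sq0 sq0n {sq0s sq0c}.
- apply: leq_trans sum_m; rewrite size_cat addnC leq_add//.
  rewrite size_flatten /shape -map_comp sumnE big_map big_enum/=.
  by apply: leq_sum => i _; rewrite size_map; case: (Hsq i).
apply: (@le_trans _ _ (\sum_i (p i)%:E * ((b i `^ r)%:E * (c * (m i)%:R `^ (- q))%:E)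
   + p0%:E * (2 * m0%:R `^ (- q))%:E)%E).
  apply: (le_trans (cost_union_le _ _ _ sq0n)) => [i|]; first by case: (Hsq i).
  apply: leeD; last by apply: lee_wpmul2l; [rewrite lee_fin ltW|exact: ltW].
  apply: lee_sum => i _; apply: lee_wpmul2l; first by rewrite lee_fin ltW.
  by apply: lee_wpmul2l; [rewrite lee_fin powR_ge0|case: (Hsq i)].
under eq_bigr do rewrite -!EFinM.
rewrite sumEFin -EFinM -EFinD lee_fin.
have Hi i : p i * (b i `^ r * (c * (m i)%:R `^ (- q))) <= t i * (c * n%:R `^ (- q)).
  rewrite mulrA tE -mulrA ler_pM2l// mulrCA ler_pM2l//.
  have [mi0 mi _] := mP i.
  have ti : t i `^ q * n%:R `^ q <= (m i)%:R `^ q.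
    rewrite -powRM ?(ltW (t0 i)) ?ler0n//; apply: ge0_ler_powR; last exact: ltW.
    - exact: ltW.
    - by rewrite nnegrE mulr_ge0// ltW.
    - by rewrite nnegrE ler0n.
  rewrite !powRN ler_pdivrMr ?powR_gt0 ?ltr0n// mulrC ler_pdivlMr ?powR_gt0//.
have H0 : p0 * (2 * m0%:R `^ (- q)) <= (1 - tau) * (c * n%:R `^ (- q)).
  apply: (@le_trans _ _ ((1 - tau) * (c1 * n%:R `^ (- q)))); last first.
    by rewrite ler_pM2l// ler_wpM2r ?powR_ge0// lerDl ltW.
  have -> : (1 - tau) * (c1 * n%:R `^ (- q)) = p0 * 2 * (e `^ (- q) * n%:R `^ (- q)).
    by rewrite /c1; field; rewrite gt_eqF.
  rewrite mulrA ler_pM2l ?mulr_gt0// -powRM ?(ltW e0)//.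
  rewrite !powRN lef_pV2 ?posrE ?powR_gt0 ?mulr_gt0 ?ltr0n//.
  by rewrite ge0_ler_powR ?(ltW q0) ?nnegrE ?mulr_ge0 ?(ltW e0)// ltW.
have -> : c * n%:R `^ (- q) =
    \sum_i t i * (c * n%:R `^ (- q)) + (1 - tau) * (c * n%:R `^ (- q)).
  by rewrite -mulr_suml -/tau -mulrDl subrKC mul1r.
by apply: lerD => //; apply: ler_sum => i _; exact: Hi.
Qed.

End upper_recursion.

(** * The dimension bounds *)

Theorem theorem3p1 (R : realType) (d N m : nat)
  (rho : 'rV[R]_d -> R) (r : R)
  (f : 'I_N -> 'rV[R]_d -> 'rV[R]_d) (a b : 'I_N -> R)
  (p0 : R) (p : 'I_N -> R)
  (X V C K : set 'rV[R]_d)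
  (g : 'I_m.+1 -> 'rV[R]_d -> 'rV[R]_d) (x0 : 'rV[R]_d)
  (nuhat : probability (borel_code m) R)
  (nu mu : probability (borel_rV R d) R)
  (Dnu : \bar R)
  (hd : (0 < d)%N) (hN : (0 < N)%N)
  (hrho : is_norm rho)
  (hr : 0 < r)
  (hab : forall i, [/\ 0 < a i, a i <= b i & b i < 1])
  (hf : forall i, bilipschitz rho (a i) (b i) (f i))
  (hp0 : 0 < p0) (hp : forall i, 0 < p i) (hp1 : p0 + \sum_i p i = 1)
  (hg : conformal_ifs X V g)
  (hC : self_conformal_set X g C)
  (hx0 : X x0)
  (hinv : shift_invariant nuhat)
  (herg : shift_ergodic nuhat)
  (hdist : bounded_distortion nuhat)
  (hnu : forall A : set (borel_rV R d), measurable A ->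
     nu A = nuhat (coding_map g x0 @^-1` A))
  (hsupp : msupport nu = C)
  (hDnu : is_quant_dim rho r nu Dnu)
  (hK : inhomogeneous_attractor f C K)
  (hmu : condensation_measure f p0 p nu K mu)
  (hssc : condensation_ssc f C K) :
  exists dr lr : R,
    [/\ unique (dim_equation r p a) dr,
        unique (dim_equation r p b) lr,
        (maxe dr%:E Dnu <= lower_quant_dim rho r mu)%E &
        ifs_ssc g C ->
          [/\ (maxe dr%:E Dnu <= lower_quant_dim rho r mu)%E,
              (lower_quant_dim rho r mu <= upper_quant_dim rho r mu)%E &
              (upper_quant_dim rho r mu <= maxe lr%:E Dnu)%E]].
Proof.
have d0 i : 0 < a i by case: (hab i).
have b0 i : 0 < b i by case: (hab i) => a0 ab _; exact: lt_le_trans ab.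
have pp i : 0 <= p i by exact: ltW.
have p1 i : p i < 1.
  rewrite -hp1 (bigD1 i)//= addrCA ltrDl ltr_pwDl// sumr_ge0//.
have c1 (c : 'I_N -> R) i : 0 < c i -> c i < 1 -> p i * c i `^ r < p i.
  move=> ci0 ci1; rewrite gtr_pMr// -ltr_ln ?posrE ?powR_gt0// ln1 ln_powR.
  by rewrite pmulr_rlt0// ln_lt0// ci0.
have dimeq (c : 'I_N -> R) : (forall i, 0 < c i) -> (forall i, c i < 1) ->
    exists s, unique (dim_equation r p c) s.
  move=> ci0 ci1; apply: dim_equation_unique => //.
    by move=> i; rewrite mulr_gt0 ?powR_gt0//= (lt_trans _ (p1 i))// c1.
  apply: (@le_lt_trans _ _ (\sum_i p i)); last by rewrite -hp1 ltrDr.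
  by apply: ler_sum => i _; rewrite ltW// c1.
have a1 i : a i < 1 by case: (hab i) => _ ab b1; exact: le_lt_trans ab b1.
have b1 i : b i < 1 by case: (hab i).
have [dr drP] := dimeq a d0 a1.
have [lr lrP] := dimeq b b0 b1.
have fa i x y : a i * rho (x - y) <= rho (f i x - f i y) by case: (hf i x y).
have fb i x y : rho (f i x - f i y) <= b i * rho (x - y) by case: (hf i x y).
have cf i : continuous (f i).
  by apply: (lipschitz_map_continuous _ hrho _ _ (ltW (b0 i)) (fb i)).
case: hmu => muE suppmu; case: hC => cC C0 _ _; case: hK => cK K0 KE.
rewrite -suppmu in cK K0 KE hssc.
have van := quant_error_vanishing rho r hrho hr mu cK K0.
have ge0 P n := quant_error_ge0 rho r P n.
have scaled n := quant_error_ge_condensation rho r f p0 p nu mu hrho cf hp0 hp muE n.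
(* The error of nu is at most that of mu divided by p0. *)
have vannu : vanishing (quant_error rho r nu).
  move=> e e0; have := van _ (mulr_gt0 hp0 e0); case=> n0 _ h; exists n0 => // n /h.
  move=> /(le_lt_trans (scaled n)); rewrite EFinM lte_pmul2l ?lte_fin//.
have lower0 : (0 <= lower_quant_dim rho r mu)%E.
  exact: (limn_einf_log_ratio_ge0 r _ hr (ge0 mu) van).
have lower_dr : (dr%:E <= lower_quant_dim rho r mu)%E.
  (* If N = 1 then dr = 0, and the bound is that the lower dimension is nonnegative. *)
  case: drP => -[dr0 sdr] _; move: dr0; rewrite le_eqVlt => /predU1P[<-//|dr0].
  have [c c0 Hc] := cost_lower_bound rho r f a p0 p C nu mu hrho hr d0 fa cf hp0
    hp cK cC C0 KE hssc muE dr dr0 hN sdr.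
  apply: (limn_einf_log_ratio_ge r _ hr (ge0 mu) van (c / 2 `^ r)) => //.
    by rewrite divr_gt0// powR_gt0.
  exists 1%N => // n /= n0; rewrite mulrAC.
  apply: cost_ge_of_centres_in_support => // s s0 sn sK.
  apply: le_trans (Hc s s0 sK); rewrite lee_fin ler_pM2l//.
  have ss : (0 < size s)%N by rewrite lt0n size_eq0.
  rewrite !powRN lef_pV2 ?posrE ?powR_gt0 ?ltr0n//.
  rewrite ge0_ler_powR ?nnegrE ?ler0n ?ler_nat//.
  by rewrite divr_ge0 ?ltW.
have lower_Dnu : (Dnu <= lower_quant_dim rho r mu)%E.
  rewrite leNgt; apply/negP => /ereal_real_dense[s /andP[ls sD]].
  have s0 : 0 < s by rewrite -lte_fin (le_lt_trans lower0).
  move: ls; apply/negP; rewrite -leNgt.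
  apply: (limn_einf_log_ratio_ge r _ hr (ge0 mu) van p0 s hp0 s0).
  rewrite -(proj1 hDnu) in sD.
  have [n0 _ h] := near_ge_of_lt_limn_einf r _ (ge0 nu) vannu s s0 sD.
  exists n0 => // n /h hn; apply: le_trans (scaled n).
  by rewrite EFinM lee_pmul2l ?lte_fin.
have lower : (maxe dr%:E Dnu <= lower_quant_dim rho r mu)%E.
  by rewrite ge_max lower_dr lower_Dnu.
exists dr, lr; split => // _; split => //; first exact: limn_einf_sup.
rewrite leNgt; apply/negP => /ereal_real_dense[s /andP[]].
rewrite gt_max lte_fin => /andP[lrs Ds]; apply/negP; rewrite -leNgt.
case: lrP => -[lr0 slr] _; have s0 := le_lt_trans lr0 lrs.
have tau1 : \sum_i (p i * b i `^ r) `^ (s / (r + s)) < 1.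
  rewrite -slr; apply: sum_powR_decreasing => //; last exact: dim_exponent_lt.
  by move=> i; rewrite mulr_gt0 ?powR_gt0//= (lt_trans _ (p1 i))// c1.
rewrite -(proj2 hDnu) in Ds.
have hnu' := near_le_of_limn_esup_lt r _ (ge0 nu) vannu s s0 Ds.
have [c c0 Hc] := quant_error_upper_bound rho r f b p0 p nu mu hrho hr b0 fb hp0 hp
  cK K0 muE s s0 tau1 hnu'.
apply: (limn_esup_log_ratio_le r _ hr (ge0 mu) van c s c0 s0).
by exists 1%N => // n /= n0; exact: Hc.
Qed.
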